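(* Let $D$ be a connected locally-finite digraph with exactly two ends. Then $D$ is connected-homogeneous if and only if it is isomorphic to $J(r)$ for some $r\in\mathbb{N}$.
   Context: A digraph is a set with an irreflexive antisymmetric arc relation $\to$; connectivity and ends refer to the underlying undirected graph (ends of a connected locally-finite graph are equivalence classes of rays, two rays being equivalent if some third ray meets each infinitely often). Locally-finite: every vertex has finitely many in- and out-neighbours. Connected-homogeneous: every isomorphism between finite connected induced subdigraphs extends to an automorphism. For $r\in\mathbb{N}$, $J(r)$ is the digraph with vertex set $\mathbb{Z}\times\{1,\dots,r\}$ and arcs $(i,x)\to(i+1,y)$ for all $i\in\mathbb{Z}$ and $x,y\in\{1,\dots,r\}$. *)

(* Defs.v *)
From Stdlib Require Import ZArith Arith List Relations.

Section Digraphs.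

Variable V : Type.
Variable arc : V -> V -> Prop.

Definition is_digraph : Prop :=
  (forall x, ~ arc x x) /\ (forall x y, arc x y -> ~ arc y x).

Definition adj (x y : V) : Prop := arc x y \/ arc y x.

Definition finite_pred (A : V -> Prop) : Prop :=
  exists l : list V, forall x, A x -> In x l.

Definition locally_finite : Prop :=
  forall x, finite_pred (fun y => arc x y) /\ finite_pred (fun y => arc y x).

Definition connected : Prop :=
  forall x y : V, clos_refl_trans V adj x y.

Definition adj_in (A : V -> Prop) (x y : V) : Prop := A x /\ A y /\ adj x y.

Definition induced_connected (A : V -> Prop) : Prop :=
  forall x y, A x -> A y -> clos_refl_trans V (adj_in A) x y.

Definition induced_iso (A B : V -> Prop) (f : V -> V) : Prop :=
  (forall x, A x -> B (f x)) /\
  (forall x y, A x -> A y -> f x = f y -> x = y) /\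
  (forall y, B y -> exists x, A x /\ f x = y) /\
  (forall x y, A x -> A y -> (arc x y <-> arc (f x) (f y))).

Definition automorphism (g : V -> V) : Prop :=
  (exists h : V -> V, (forall x, h (g x) = x) /\ (forall y, g (h y) = y)) /\
  (forall x y, arc x y <-> arc (g x) (g y)).

Definition connected_homogeneous : Prop :=
  forall (A B : V -> Prop) (f : V -> V),
    finite_pred A -> finite_pred B ->
    induced_connected A -> induced_connected B ->
    induced_iso A B f ->
    exists g : V -> V, automorphism g /\ (forall x, A x -> g x = f x).

Definition ray (r : nat -> V) : Prop :=
  (forall m n, r m = r n -> m = n) /\ (forall n, adj (r n) (r (S n))).

(* The ray s meets the ray r infinitely often (s is injective, so this means
   infinitely many common vertices). *)
Definition meets_inf (s r : nat -> V) : Prop :=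
  forall N, exists n m, (N <= n)%nat /\ s n = r m.

Definition ray_equiv (r1 r2 : nat -> V) : Prop :=
  exists s, ray s /\ meets_inf s r1 /\ meets_inf s r2.

Definition has_exactly_two_ends : Prop :=
  exists r1 r2, ray r1 /\ ray r2 /\ ~ ray_equiv r1 r2 /\
    forall r, ray r -> ray_equiv r r1 \/ ray_equiv r r2.

End Digraphs.
Arguments is_digraph {V}. Arguments adj {V}. Arguments finite_pred {V}. Arguments locally_finite {V}. Arguments connected {V}. Arguments adj_in {V}. Arguments induced_connected {V}. Arguments induced_iso {V}. Arguments automorphism {V}. Arguments connected_homogeneous {V}. Arguments ray {V}. Arguments meets_inf {V}. Arguments ray_equiv {V}. Arguments has_exactly_two_ends {V}.

Definition digraph_iso {V W : Type} (arcV : V -> V -> Prop) (arcW : W -> W -> Prop)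
  (f : V -> W) : Prop :=
  (exists h : W -> V, (forall x, h (f x) = x) /\ (forall y, f (h y) = y)) /\
  (forall x y, arcV x y <-> arcW (f x) (f y)).

Definition isomorphic {V W : Type} (arcV : V -> V -> Prop) (arcW : W -> W -> Prop) : Prop :=
  exists f : V -> W, digraph_iso arcV arcW f.

Definition Jvert (r : nat) : Type := (Z * { x : nat | (1 <= x <= r)%nat })%type.

Definition Jarc (r : nat) (u v : Jvert r) : Prop := fst v = (fst u + 1)%Z.

(* Main.v *)
(**
In a two-ended vertex-transitive graph fix a set [X], with [X] and its complement infinite and
finite boundary. Every set commensurable with [X] whose boundary lies in the ball of a large radius
[R] about [x] is a way of cutting the ends apart at [x]; let [side X x] be the union of these sets.
Put [w x v = 1_{side X x} v - 1_{side (compl X) x} v]. An automorphism fixes or exchanges the two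
ends, hence preserves [w] up to a global sign, and [sum_v (w x v - w y v)] is a cocycle preserved
up to sign. The cuts at two vertices far apart are nested, so the cocycle does not vanish on them,
and it integrates to a height function with finite fibres. By arc-transitivity the height changes
by [d] or [-d] along every arc, with [d] nonzero; then there are no triangles, all directed 2-paths
are equivalent under automorphisms, and this forces the sign to be the same on all arcs. So the
digraph is layered over Z with finite layers.

In a layered connected-homogeneous digraph, suppose no two vertices have the same in-neighbours.
An automorphism fixing a layer pointwise then fixes everything above it, contradicting the
freedom to exchange two children of a vertex one layer higher. So in-twins exist whenever some
vertex has two children, and homogeneity makes all siblings in-twins. Replacing a vertex by an
in-twin while fixing what is below shows that siblings also have the same out-neighbours. With the
dual statements, consecutive layers are completely joined.

Conversely, an isomorphism between finite connected subdigraphs of J(r) shifts all layers by the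
same amount, so it extends layer by layer.
*)

Require Import Defs.
From Stdlib Require Import ZArith List Relations Lia Permutation Sorted FinFun.
From Stdlib Require Import ClassicalEpsilon PropExtensionality FunctionalExtensionality.
Import ListNotations.

Definition dec (P : Prop) : {P} + {~ P} := excluded_middle_informative P.

Lemma functional_choice {A B : Type} (R : A -> B -> Prop) :
  (forall x, exists y, R x y) -> exists f, forall x, R x (f x).
Proof.
  intros H. exists (fun x => proj1_sig (constructive_indefinite_description _ (H x))).
  intros x. exact (proj2_sig (constructive_indefinite_description _ (H x))).
Qed.

Lemma injective_surjective_bijective {V W : Type} (f : V -> W) :
  Injective f -> Surjective f -> Bijective f.
Proof. intros Hinj Hsurj. destruct (functional_choice _ Hsurj) as [g Hg]. exists g. auto. Qed.

Lemma dependent_choice {T : Type} (P : nat -> T -> Prop) (R : T -> T -> Prop) (t0 : T) :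
  P 0 t0 -> (forall n t, P n t -> exists u, P (S n) u /\ R t u) ->
  exists s, s 0 = t0 /\ forall n, P n (s n) /\ R (s n) (s (S n)).
Proof.
  intros P0 HP.
  set (next := fun n t => epsilon (inhabits t0) (fun u => P (S n) u /\ R t u)).
  set (s := fix s n := match n with 0 => t0 | S n => next n (s n) end).
  assert (Hnext : forall n t, P n t -> P (S n) (next n t) /\ R t (next n t)).
  { intros n t Ht. apply epsilon_spec. now apply HP. }
  assert (Hs : forall n, P n (s n)).
  { induction n as [|n IH]; [exact P0|]. now apply Hnext. }
  exists s. split; [reflexivity|]. intros n. split; [apply Hs|]. now apply Hnext.
Qed.

Lemma bounded_has_last (P : nat -> Prop) m N :
  P m -> (forall k, N <= k -> ~ P k) -> exists k, m <= k /\ P k /\ forall j, k < j -> ~ P j.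
Proof.
  intros Hm HN. apply NNPP. intros Hno.
  assert (H : forall d, exists k, m + d <= k /\ P k).
  { induction d as [|d [k [Hk Pk]]]; [exists m; split; auto; lia|].
    apply NNPP. intros Hd. apply Hno. exists k. repeat split; auto; [lia|].
    intros j Hj Pj. apply Hd. exists j. split; auto; lia. }
  destruct (H N) as [k [Hk Pk]]. apply (HN k); auto; lia.
Qed.

(** * Finite predicates *)

Definition enumerates {V : Type} (l : list V) (A : V -> Prop) : Prop :=
  NoDup l /\ forall x, In x l <-> A x.

Definition has_card {V : Type} (A : V -> Prop) (n : nat) : Prop :=
  exists l, enumerates l A /\ length l = n.

Definition bijection_on {V W : Type} (A : V -> Prop) (B : W -> Prop) (f : V -> W) : Prop :=
  (forall x, A x -> B (f x)) /\
  (forall x y, A x -> A y -> f x = f y -> x = y) /\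
  (forall y, B y -> exists x, A x /\ f x = y).

Section FinitePredicates.

Context {V : Type}.
Implicit Types A B : V -> Prop.

Lemma finite_subset A B : (forall x, A x -> B x) -> finite_pred B -> finite_pred A.
Proof. intros H [l Hl]. exists l. auto. Qed.

Lemma finite_empty A : (forall x, ~ A x) -> finite_pred A.
Proof. intros H. exists []. intros x Hx. now apply (H x). Qed.

Lemma finite_union A B : finite_pred A -> finite_pred B -> finite_pred (fun x => A x \/ B x).
Proof. intros [l Hl] [m Hm]. exists (l ++ m). intros x [H|H]; apply in_or_app; auto. Qed.

Lemma finite_singleton (a : V) : finite_pred (fun x => x = a).
Proof. exists [a]. intros x ->. now left. Qed.

Lemma finite_enumerated A : finite_pred A -> exists l, enumerates l A.
Proof.
  intros [l Hl].
  exists (nodup (fun x y => dec (x = y)) (filter (fun x => if dec (A x) then true else false) l)).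
  split; [apply NoDup_nodup|]. intros x. rewrite nodup_In, filter_In.
  destruct (dec (A x)); intuition; discriminate.
Qed.

Lemma enumeration_extends l A n : NoDup l -> (forall x, In x l -> A x) -> has_card A n ->
  exists m, enumerates (l ++ m) A /\ length (l ++ m) = n.
Proof.
  intros Hl HA [k [[Hk HkA] <-]].
  set (m := filter (fun x => if dec (In x l) then false else true) k).
  assert (Hm : forall x, In x m <-> A x /\ ~ In x l).
  { intros x. unfold m. rewrite filter_In, HkA.
    destruct (dec (In x l)); intuition discriminate. }
  exists m. assert (H : enumerates (l ++ m) A).
  { split.
    - apply NoDup_app; auto; [now apply NoDup_filter|]. intros x Hx. rewrite Hm. tauto.
    - intros x. rewrite in_app_iff, Hm. destruct (classic (In x l)); intuition. }
  split; auto. apply Permutation_length, NoDup_Permutation; auto; [apply H|].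
  intros x. now rewrite HkA, (proj2 H).
Qed.

End FinitePredicates.

Section FiniteMaps.

Context {V W : Type}.
Implicit Types A : V -> Prop.
Implicit Types B : W -> Prop.

Lemma finite_bigunion (I : W -> Prop) (A : W -> V -> Prop) :
  finite_pred I -> (forall i, I i -> finite_pred (A i)) ->
  finite_pred (fun x => exists i, I i /\ A i x).
Proof.
  intros [l Hl] HA.
  assert (H : finite_pred (fun x => exists i, In i l /\ I i /\ A i x)).
  { clear Hl. induction l as [|i l IH].
    - apply finite_empty. intros x [i [[] _]].
    - destruct (classic (I i)) as [Hi|Hi].
      + apply finite_subset with (B := fun x => A i x \/ exists j, In j l /\ I j /\ A j x).
        * intros x [j [[->|Hj] [Hjx Hx]]]; [now left|right; eauto].
        * apply finite_union; auto.
      + apply finite_subset with (2 := IH).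
        intros x [j [[->|Hj] [Hjx Hx]]]; [contradiction|eauto]. }
  apply finite_subset with (2 := H). intros x [i [Hi Hx]]. eauto.
Qed.

Lemma finite_preimage B (f : V -> W) :
  Injective f -> finite_pred B -> finite_pred (fun x => B (f x)).
Proof.
  intros Hf HB. apply finite_subset with (B := fun x => exists y, B y /\ f x = y); [eauto|].
  apply finite_bigunion; auto. intros y _.
  destruct (classic (exists x, f x = y)) as [[x <-]|Hno].
  - apply finite_subset with (2 := finite_singleton x). intros x'. apply Hf.
  - apply finite_empty. eauto.
Qed.

Lemma NoDup_map_injective (f : V -> W) l x y :
  NoDup (map f l) -> In x l -> In y l -> f x = f y -> x = y.
Proof.
  induction l as [|a l IH]; simpl; [tauto|]. intros Hn Hx Hy E.
  apply NoDup_cons_iff in Hn. destruct Hn as [Ha Hn], Hx as [->|Hx], Hy as [->|Hy]; auto.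
  - destruct Ha. rewrite E. now apply in_map.
  - destruct Ha. rewrite <- E. now apply in_map.
Qed.

Lemma has_card_bijection A B f n :
  bijection_on A B f -> has_card A n -> has_card B n.
Proof.
  intros [Hmap [Hinj Hsurj]] [l [[Hl HA] Hlen]]. exists (map f l). split; [split|].
  - apply Injective_map_NoDup_in; auto. intros x y Hx Hy. apply Hinj; now apply HA.
  - intros y. rewrite in_map_iff. split.
    + intros [x [<- Hx]]. now apply Hmap, HA.
    + intros Hy. destruct (Hsurj y Hy) as [x [Hx <-]]. exists x. split; auto. now apply HA.
  - now rewrite length_map.
Qed.

Lemma has_card_surjective_injective A B f n : has_card A n -> has_card B n ->
  (forall y, B y -> exists x, A x /\ f x = y) -> forall x x', A x -> A x' -> f x = f x' -> x = x'.
Proof.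
  intros [l [[Hl HA] Hlen]] [m [[Hm HB] Hlen']] Hsurj x x' Hx Hx'.
  apply (NoDup_map_injective f l); try now apply HA.
  apply NoDup_incl_NoDup with m; auto; [rewrite length_map; lia|].
  intros y Hy. apply HB, Hsurj in Hy. destruct Hy as [a [Ha <-]]. now apply in_map, HA.
Qed.

(* [f] only provides an element of [W] when [l] is empty. *)
Lemma exists_map_eq (f : V -> W) (l : list V) (m : list W) :
  NoDup l -> length l = length m -> exists b, map b l = m.
Proof.
  revert m. induction l as [|a l IH]; intros [|y m] Hl Hlen; try discriminate.
  - now exists f.
  - apply NoDup_cons_iff in Hl. destruct Hl as [Ha Hl], (IH m Hl) as [b Hb]; auto.
    exists (fun x => if dec (x = a) then y else b x). simpl.
    destruct (dec (a = a)); [|congruence]. rewrite <- Hb. f_equal.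
    apply map_ext_in. intros x Hx. destruct (dec (x = a)); congruence.
Qed.

Lemma bijection_on_of_map A B l b :
  enumerates l A -> enumerates (map b l) B -> bijection_on A B b.
Proof.
  intros [Hl HA] [Hm HB]. repeat split.
  - intros x Hx. now apply HB, in_map, HA.
  - intros x y Hx Hy. apply (NoDup_map_injective b l); auto; now apply HA.
  - intros y Hy. apply HB, in_map_iff in Hy. destruct Hy as [x [E Hx]]. exists x.
    split; auto. now apply HA.
Qed.

Lemma partial_injection_extends A B (P : V -> Prop) f n :
  has_card A n -> has_card B n ->
  (forall x, A x -> P x -> B (f x)) ->
  (forall x y, A x -> P x -> A y -> P y -> f x = f y -> x = y) ->
  exists b, bijection_on A B b /\ forall x, A x -> P x -> b x = f x.
Proof.
  intros HA HB Hf Hinj.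
  destruct (finite_enumerated (fun x => A x /\ P x)) as [l [Hl Hin]].
  { destruct HA as [k [[_ Hk] _]]. exists k. intros x Hx. now apply Hk. }
  destruct (enumeration_extends l A n) as [l' [Hl' Len]]; auto.
  { intros x Hx. now apply Hin. }
  destruct (enumeration_extends (map f l) B n) as [m' [Hm' Len']]; auto.
  - apply Injective_map_NoDup_in; auto.
    intros x y Hx Hy. apply Hin in Hx, Hy. now apply Hinj.
  - intros y Hy. apply in_map_iff in Hy. destruct Hy as [x [<- Hx]].
    apply Hin in Hx. now apply Hf.
  - destruct (exists_map_eq f (l ++ l') (map f l ++ m')) as [b Hb]; [apply Hl'|congruence|].
    exists b. split.
    + apply bijection_on_of_map with (l ++ l'); auto. now rewrite Hb.
    + intros x Ax Px. apply (f_equal (firstn (length l))) in Hb.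
      rewrite map_app, !firstn_app, !length_map, Nat.sub_diag, !firstn_O, !app_nil_r,
        !firstn_map, firstn_all, map_ext_in_iff in Hb.
      now apply Hb, Hin.
Qed.

End FiniteMaps.

(** * Complements and commensurability *)

Definition compl {V : Type} (X : V -> Prop) : V -> Prop := fun v => ~ X v.

Definition commensurable {V : Type} (X Y : V -> Prop) : Prop :=
  finite_pred (fun v => ~ (X v <-> Y v)).

Section Commensurability.

Context {V : Type}.
Implicit Types X Y Z : V -> Prop.

Lemma compl_involutive X : compl (compl X) = X.
Proof.
  apply functional_extensionality. intros v. apply propositional_extensionality.
  split; [apply NNPP|]. unfold compl. tauto.
Qed.

Lemma commensurable_sym X Y : commensurable X Y -> commensurable Y X.
Proof. apply finite_subset. tauto. Qed.

Lemma commensurable_trans X Y Z : commensurable X Y -> commensurable Y Z -> commensurable X Z.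
Proof.
  intros HXY HYZ. apply finite_subset with (2 := finite_union _ _ HXY HYZ). intros v.
  destruct (classic (X v <-> Y v)); tauto.
Qed.

Lemma commensurable_compl X Y : commensurable X Y -> commensurable (compl X) (compl Y).
Proof. apply finite_subset. unfold compl. tauto. Qed.

Lemma commensurable_compl_l X Y : commensurable (compl X) Y -> commensurable X (compl Y).
Proof. intros H. apply commensurable_compl in H. now rewrite compl_involutive in H. Qed.

Lemma commensurable_preimage X Y (g : V -> V) : Injective g -> commensurable X Y ->
  commensurable (fun v => X (g v)) (fun v => Y (g v)).
Proof. intros Hg H. exact (finite_preimage _ g Hg H). Qed.

Lemma commensurable_sandwich X Y Z : commensurable X Z ->
  (forall v, X v -> Y v) -> (forall v, Y v -> Z v) -> commensurable X Y.
Proof. intros H HXY HYZ. apply finite_subset with (2 := H). intros v. firstorder. Qed.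

Lemma commensurable_finite X Y : commensurable X Y -> finite_pred X -> finite_pred Y.
Proof.
  intros H HX. apply finite_subset with (2 := finite_union _ _ H HX). intros v.
  destruct (classic (X v)); tauto.
Qed.

End Commensurability.

(** * Finitely supported sums *)

Section Sums.

Context {V : Type}.
Implicit Types f g : V -> Z.
Open Scope Z_scope.

Definition sum_over f (l : list V) : Z := fold_right (fun v s => f v + s) 0 l.

Definition finite_support f : Prop := finite_pred (fun v => f v <> 0).

(* Meaningful only for finitely supported functions. *)
Definition fsum f : Z := epsilon (inhabits 0) (fun s =>
  forall l, NoDup l -> (forall v, f v <> 0 -> In v l) -> s = sum_over f l).

Lemma sum_over_permutation f l m : Permutation l m -> sum_over f l = sum_over f m.
Proof. unfold sum_over. induction 1; simpl; lia. Qed.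

Lemma sum_over_filter_nonzero f l :
  sum_over f (filter (fun v => negb (f v =? 0)) l) = sum_over f l.
Proof.
  unfold sum_over. induction l as [|a l IH]; simpl; auto.
  destruct (Z.eqb_spec (f a) 0); simpl; lia.
Qed.

Lemma fsum_eq_sum_over f l :
  NoDup l -> (forall v, f v <> 0 -> In v l) -> fsum f = sum_over f l.
Proof.
  intros Hl Hf. unfold fsum.
  apply (epsilon_spec (inhabits 0) (fun s =>
    forall l, NoDup l -> (forall v, f v <> 0 -> In v l) -> s = sum_over f l)); auto.
  exists (sum_over f l).
  intros m Hm Hf'. rewrite <- (sum_over_filter_nonzero f l), <- (sum_over_filter_nonzero f m).
  apply sum_over_permutation, NoDup_Permutation; auto using NoDup_filter.
  intros v. rewrite !filter_In.
  destruct (Z.eqb_spec (f v) 0); simpl; [intuition discriminate|]. intuition.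
Qed.

Lemma fsum_add f g : finite_support f -> finite_support g ->
  fsum (fun v => f v + g v) = fsum f + fsum g.
Proof.
  intros Hf Hg. destruct (finite_enumerated _ (finite_union _ _ Hf Hg)) as [l [Hl Hin]].
  rewrite !(fsum_eq_sum_over _ l); auto; try (intros v Hv; apply Hin; lia).
  clear. unfold sum_over. induction l; simpl; lia.
Qed.

Lemma fsum_opp f : finite_support f -> fsum (fun v => - f v) = - fsum f.
Proof.
  intros Hf. destruct (finite_enumerated _ Hf) as [l [Hl Hin]].
  rewrite !(fsum_eq_sum_over _ l); auto; try (intros v Hv; apply Hin; lia).
  clear. unfold sum_over. induction l; simpl; lia.
Qed.

Lemma fsum_bijective f (g : V -> V) : Bijective g -> finite_support f ->
  fsum (fun v => f (g v)) = fsum f.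
Proof.
  intros [h [Hhg Hgh]] Hf. destruct (finite_enumerated _ Hf) as [l [Hl Hin]].
  assert (Hinj : Injective h) by (intros x y E; now rewrite <- (Hgh x), <- (Hgh y), E).
  rewrite (fsum_eq_sum_over f l), (fsum_eq_sum_over _ (map h l)); auto; try apply Hin.
  - clear - Hgh. unfold sum_over. induction l as [|a l IH]; simpl; [auto|]. now rewrite IH, Hgh.
  - now apply Injective_map_NoDup.
  - intros v Hv. rewrite <- (Hhg v). now apply in_map, Hin.
Qed.

Lemma sum_over_nonneg f l : (forall u, 0 <= f u) -> 0 <= sum_over f l.
Proof.
  intros Hf. unfold sum_over. induction l as [|a l IH]; simpl; [lia|]. specialize (Hf a). lia.
Qed.

Lemma sum_over_pos f l v : (forall u, 0 <= f u) -> In v l -> 0 < f v -> 0 < sum_over f l.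
Proof.
  intros Hf Hin Hv. induction l as [|a l IH]; [destruct Hin|].
  change (0 < f a + sum_over f l). pose proof (sum_over_nonneg f l Hf) as Hl.
  destruct Hin as [->|Hin]; [lia|]. specialize (Hf a). specialize (IH Hin). lia.
Qed.

Lemma fsum_pos f v : finite_support f -> (forall u, 0 <= f u) -> 0 < f v -> 0 < fsum f.
Proof.
  intros Hf Hnonneg Hv. destruct (finite_enumerated _ Hf) as [l [Hl Hin]].
  rewrite (fsum_eq_sum_over f l); [|auto|apply Hin].
  apply sum_over_pos with v; auto. apply Hin. lia.
Qed.

End Sums.

(** * Connected graphs, balls and automorphisms *)

Section Graph.

Context {V : Type} (arc : V -> V -> Prop).
Notation adj := (adj arc).
Notation rt := (clos_refl_trans V).

Lemma adj_sym x y : adj x y -> adj y x.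
Proof. intros [H|H]; [right|left]; auto. Qed.

Lemma rt_sym (R : V -> V -> Prop) x y :
  (forall a b, R a b -> R b a) -> rt R x y -> rt R y x.
Proof.
  intros HR. induction 1; [apply rt_step; auto|apply rt_refl|eapply rt_trans; eauto].
Qed.

Lemma rt_mono (R Q : V -> V -> Prop) x y :
  (forall a b, R a b -> Q a b) -> rt R x y -> rt Q x y.
Proof.
  intros HR. induction 1; [apply rt_step; auto|apply rt_refl|eapply rt_trans; eauto].
Qed.

Lemma rt_invariant (R : V -> V -> Prop) (P : V -> Prop) x y :
  (forall a b, P a -> R a b -> P b) -> rt R x y -> P x -> P y.
Proof. intros HP. induction 1; eauto. Qed.

Lemma connected_invariant (P : V -> Prop) : connected arc ->
  (forall a b, P a -> adj a b -> P b) -> forall a b, P a -> P b.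
Proof. intros Hc HP a b. eapply rt_invariant; [exact HP|apply Hc]. Qed.

Lemma adj_in_sym A x y : adj_in arc A x y -> adj_in arc A y x.
Proof. intros [Hx [Hy Hxy]]. repeat split; auto using adj_sym. Qed.

Lemma rt_adj_in_sub (A B : V -> Prop) x y : (forall v, A v -> B v) ->
  rt (adj_in arc A) x y -> rt (adj_in arc B) x y.
Proof. intros H. apply rt_mono. intros a b [Ha [Hb Hab]]. repeat split; auto. Qed.

Lemma induced_connected_singleton a : induced_connected arc (fun x => x = a).
Proof. intros x y -> ->. apply rt_refl. Qed.

Lemma induced_connected_union_neighbours A B : induced_connected arc A ->
  (forall b, B b -> exists a, A a /\ adj a b) -> induced_connected arc (fun x => A x \/ B x).
Proof.
  intros HA HB.
  assert (Hanchor : forall x, A x \/ B x ->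
            exists a, A a /\ rt (adj_in arc (fun v => A v \/ B v)) a x).
  { intros x [Hx|Hx]; [exists x; split; auto; apply rt_refl|].
    destruct (HB x Hx) as [a [Ha Hax]]. exists a. split; auto.
    apply rt_step. repeat split; auto. }
  intros x y Hx Hy. destruct (Hanchor x Hx) as [a [Ha Hax]], (Hanchor y Hy) as [b [Hb Hby]].
  apply rt_trans with a; [apply rt_sym; auto; apply adj_in_sym|].
  apply rt_trans with b; auto. apply rt_adj_in_sub with (A := A); auto.
Qed.

Lemma induced_connected_add A u z : induced_connected arc A -> A u -> adj u z ->
  induced_connected arc (fun x => A x \/ x = z).
Proof. intros HA Hu Huz. apply induced_connected_union_neighbours; auto. intros b ->. eauto. Qed.

Fixpoint ball (n : nat) (x y : V) : Prop :=
  match n with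
  | 0 => y = x
  | S n => ball n x y \/ exists z, ball n x z /\ adj z y
  end.

Lemma ball_center n x : ball n x x.
Proof. induction n; simpl; auto. Qed.

Lemma ball_mono n m x y : n <= m -> ball n x y -> ball m x y.
Proof. induction 1; simpl; auto. Qed.

Lemma ball_cons n x y z : adj x y -> ball n y z -> ball (S n) x z.
Proof.
  intros Hxy. revert z. induction n as [|n IH]; intros z Hz.
  - simpl in Hz. subst z. right. exists x. split; [apply ball_center|auto].
  - destruct Hz as [Hz|[t [Ht Hz]]]; [left; auto|right; exists t; auto].
Qed.

Lemma ball_sym n x y : ball n x y -> ball n y x.
Proof.
  revert y. induction n as [|n IH]; intros y H; [now symmetry|].
  destruct H as [H|[z [Hz Hzy]]]; [left; auto|]. apply ball_cons with z; auto using adj_sym.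
Qed.

Lemma ball_add n m x y z : ball n x y -> ball m y z -> ball (n + m) x z.
Proof.
  revert z. induction m as [|m IH]; intros z Hxy Hyz.
  - simpl in Hyz. subst z. now rewrite Nat.add_0_r.
  - rewrite Nat.add_succ_r. destruct Hyz as [Hyz|[t [Hyt Htz]]]; [left; auto|right; eauto].
Qed.

Lemma ball_induced_connected n x : induced_connected arc (ball n x).
Proof.
  induction n as [|n IH]; [apply induced_connected_singleton|].
  now apply induced_connected_union_neighbours.
Qed.

Lemma finite_adj x : locally_finite arc -> finite_pred (adj x).
Proof. intros H. destruct (H x). now apply finite_union. Qed.

Lemma finite_ball n x : locally_finite arc -> finite_pred (ball n x).
Proof.
  intros Hlf. induction n as [|n IH]; [apply finite_singleton|].
  apply finite_union; auto. apply finite_bigunion; auto. intros z _. now apply finite_adj.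
Qed.

Lemma finite_in_ball (A : V -> Prop) x : connected arc -> finite_pred A ->
  exists n, forall y, A y -> ball n x y.
Proof.
  intros Hc [l Hl].
  assert (H : exists n, forall y, In y l -> ball n x y).
  { clear Hl. induction l as [|a l [n IH]]; [exists 0; intros y []|].
    assert (Ha : exists m, ball m x a).
    { apply (connected_invariant (fun y => exists m, ball m x y) Hc) with x.
      - intros b c [m Hm] Hbc. exists (S m). right. eauto.
      - now exists 0. }
    destruct Ha as [m Hm]. exists (Nat.max n m). intros y [<-|Hy].
    - apply ball_mono with m; auto; lia.
    - apply ball_mono with n; auto; lia. }
  destruct H as [n Hn]. eauto.
Qed.

Lemma infinite_outside_ball (A : V -> Prop) n x : locally_finite arc -> ~ finite_pred A ->
  exists y, A y /\ ~ ball n x y.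
Proof.
  intros Hlf HA. apply NNPP. intros Hno. apply HA.
  apply finite_subset with (2 := finite_ball n x Hlf). intros y Hy.
  apply NNPP. intros Hball. apply Hno. eauto.
Qed.

Lemma automorphism_inverse g : automorphism arc g ->
  exists h, automorphism arc h /\ (forall x, h (g x) = x) /\ (forall y, g (h y) = y).
Proof.
  intros [[h [Hhg Hgh]] Hg]. exists h. split; [|auto]. split.
  - exists g. auto.
  - intros x y. rewrite (Hg (h x) (h y)), !Hgh. tauto.
Qed.

Lemma automorphism_arc g x y : automorphism arc g -> (arc (g x) (g y) <-> arc x y).
Proof. intros [_ Hg]. symmetry. apply Hg. Qed.

Lemma automorphism_adj g x y : automorphism arc g -> (adj (g x) (g y) <-> adj x y).
Proof. intros [_ Hg]. unfold Defs.adj. now rewrite <- !Hg. Qed.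

Lemma automorphism_injective g : automorphism arc g -> Injective g.
Proof. intros [[h [Hhg _]] _] x y E. now rewrite <- (Hhg x), <- (Hhg y), E. Qed.

Lemma automorphism_preimage_finite g (A : V -> Prop) : automorphism arc g ->
  finite_pred (fun v => A (g v)) -> finite_pred A.
Proof.
  intros Hg HA. destruct (automorphism_inverse g Hg) as [h [Hh [_ Hgh]]].
  apply (finite_preimage _ h (automorphism_injective h Hh)) in HA.
  apply finite_subset with (2 := HA). intros v. now rewrite Hgh.
Qed.

Lemma automorphism_ball_sub g n x y : automorphism arc g -> ball n x y -> ball n (g x) (g y).
Proof.
  intros Hg. revert y. induction n as [|n IH]; intros y; simpl; [now intros ->|].
  intros [H|[z [Hz Hzy]]]; auto. right. exists (g z). now rewrite automorphism_adj; auto.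
Qed.

Lemma automorphism_ball g n x y : automorphism arc g -> (ball n (g x) (g y) <-> ball n x y).
Proof.
  intros Hg. split; [|now apply automorphism_ball_sub].
  destruct (automorphism_inverse g Hg) as [h [Hh [Hhg _]]].
  rewrite <- (Hhg x) at 2. rewrite <- (Hhg y) at 2. now apply automorphism_ball_sub.
Qed.

End Graph.

Definition vertex_transitive {V : Type} (arc : V -> V -> Prop) : Prop :=
  forall x y, exists g, automorphism arc g /\ g x = y.

(** * Rays joined by infinitely many paths are equivalent *)

Definition eventually_in {V : Type} (r : nat -> V) (X : V -> Prop) : Prop :=
  exists N, forall n, N <= n -> X (r n).

Section Sequences.

Context {V : Type}.
Implicit Types (r : nat -> V) (X Y : V -> Prop).

Lemma eventually_in_sub r X Y : (forall v, X v -> Y v) -> eventually_in r X -> eventually_in r Y.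
Proof. intros H [N HN]. exists N. auto. Qed.

Lemma eventually_in_and r X Y : eventually_in r X -> eventually_in r Y ->
  eventually_in r (fun v => X v /\ Y v).
Proof. intros [N HN] [M HM]. exists (N + M). intros n Hn. split; [apply HN|apply HM]; lia. Qed.

Lemma eventually_in_inhabited r X : eventually_in r X -> exists v, X v.
Proof. intros [N HN]. exists (r N). now apply HN. Qed.

Lemma injective_eventually_outside r X :
  Injective r -> finite_pred X -> eventually_in r (compl X).
Proof.
  intros Hr [l Hl]. apply eventually_in_sub with (X := fun v => ~ In v l); [firstorder|].
  clear X Hl. induction l as [|a l IH]; [exists 0; auto|].
  apply eventually_in_sub with (X := fun v => v <> a /\ ~ In v l); [simpl; intuition|].
  apply eventually_in_and; auto.
  destruct (classic (exists k, r k = a)) as [[k <-]|Hno].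
  - exists (S k). intros n Hn E. apply Hr in E. lia.
  - exists 0. intros n _ E. eauto.
Qed.

Lemma eventually_in_infinite r X : Injective r -> eventually_in r X -> ~ finite_pred X.
Proof.
  intros Hr HX Hfin. apply (injective_eventually_outside r X Hr) in Hfin.
  destruct (eventually_in_inhabited _ _ (eventually_in_and _ _ _ HX Hfin)) as [v [Hv Hv']]. auto.
Qed.

End Sequences.

(* [Sorted R l] only relates consecutive entries, so [Sorted adj l] says that [l] is a walk. *)
Section Walks.

Context {V : Type} (R : V -> V -> Prop).

Lemma Sorted_app_r l m : Sorted R (l ++ m) -> Sorted R m.
Proof. induction l as [|a l IH]; simpl; auto. intros H. now apply IH, (Sorted_inv H). Qed.

Lemma Sorted_nth l d i : Sorted R l -> S i < length l -> R (nth i l d) (nth (S i) l d).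
Proof.
  revert i. induction l as [|a [|b l] IH]; simpl; intros i Hl Hi; try lia.
  apply Sorted_inv in Hl. destruct Hl as [Hl Hab], i as [|i].
  - now apply HdRel_inv in Hab.
  - apply IH; auto. simpl. lia.
Qed.

Hypothesis R_sym : forall x y, R x y -> R y x.

Lemma simple_path_extends l x y : NoDup (x :: l) -> Sorted R (x :: l) ->
  clos_refl_trans V (fun a b => R a b /\ ~ In b l) x y ->
  exists q, NoDup (y :: q ++ l) /\ Sorted R (y :: q ++ l).
Proof.
  intros Hnd Hs Hxy. induction Hxy as [|y z _ [q [IHnd IHs]] [Hyz Hz]]
    using clos_refl_trans_ind_left; [now exists []|].
  destruct (classic (In z (y :: q))) as [Hin|Hin].
  - apply in_split in Hin. destruct Hin as [l1 [l2 E]]. exists l2.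
    assert (E' : y :: q ++ l = l1 ++ z :: l2 ++ l).
    { change (y :: q ++ l) with ((y :: q) ++ l). now rewrite E, <- app_assoc. }
    rewrite E' in IHnd, IHs. split.
    + now apply NoDup_app_remove_l in IHnd.
    + now apply Sorted_app_r in IHs.
  - exists (y :: q). split.
    + constructor; auto. rewrite in_app_iff. tauto.
    + constructor; auto. constructor. auto.
Qed.

Lemma growing_paths_limit (st : nat -> list V) : st 0 <> [] ->
  (forall n, NoDup (st n) /\ Sorted R (st n)) ->
  (forall n, exists q, q <> [] /\ st (S n) = q ++ st n) ->
  exists s, Injective s /\ (forall n, R (s n) (s (S n))) /\
    forall n, exists k, n <= k /\ hd_error (st n) = Some (s k).
Proof.
  intros Hne Hpath Hgrow. destruct (st 0) as [|d l0] eqn:E0; [congruence|].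
  assert (Hlen : forall n, n < length (st n)).
  { induction n as [|n IH]; [rewrite E0; simpl; lia|].
    destruct (Hgrow n) as [q [Hq ->]]. rewrite length_app.
    destruct q; [congruence|simpl; lia]. }
  assert (Hstable : forall n m j, n <= m -> j < length (st n) ->
            j < length (st m) /\ nth j (rev (st m)) d = nth j (rev (st n)) d).
  { intros n m j Hnm Hj. induction Hnm as [|m Hnm [IHlen IH]]; auto.
    destruct (Hgrow m) as [q [_ ->]]. rewrite length_app, rev_app_distr.
    split; [lia|]. rewrite app_nth1; auto. now rewrite length_rev. }
  set (s := fun n => nth n (rev (st n)) d).
  assert (Hs : forall n j, j < length (st n) -> s j = nth j (rev (st n)) d).
  { intros n j Hj. unfold s. transitivity (nth j (rev (st (Nat.max n j))) d).
    - symmetry. apply Hstable; [lia|apply Hlen].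
    - apply Hstable; [lia|auto]. }
  exists s. split; [|split].
  - intros m n E. pose proof (Hlen (Nat.max m n)) as L.
    rewrite !(Hs (Nat.max m n)) in E by lia.
    destruct (Hpath (Nat.max m n)) as [Hnd _].
    apply (proj1 (NoDup_nth _ d) (NoDup_rev Hnd)) in E; auto; rewrite length_rev; lia.
  - intros n. pose proof (Hlen (S n)) as L. rewrite !(Hs (S n)), !rev_nth by lia.
    replace (length (st (S n)) - S n) with (S (length (st (S n)) - S (S n))) by lia.
    apply R_sym, Sorted_nth; [apply Hpath|lia].
  - intros n. pose proof (Hlen n) as L. exists (length (st n) - 1). split; [lia|].
    rewrite (Hs n), rev_nth by lia. destruct (st n) as [|a l]; simpl in *; [lia|].
    now replace (length l - (length l - 0)) with 0 by lia.
Qed.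

End Walks.

Section InseparableRays.

Context {V : Type} (arc : V -> V -> Prop).
Notation adj := (adj arc).

Definition inseparable (a b : nat -> V) : Prop := forall F : list V, exists i j,
  ~ In (a i) F /\ ~ In (b j) F /\ clos_refl_trans V (adj_in arc (fun v => ~ In v F)) (a i) (b j).

Lemma inseparable_sym a b : inseparable a b -> inseparable b a.
Proof.
  intros H F. destruct (H F) as [i [j [Hi [Hj Hij]]]]. exists j, i. repeat split; auto.
  apply rt_sym; auto. apply adj_in_sym.
Qed.

(* A path listed backwards: its last vertex comes first and lies on [r]. *)
Definition path_avoiding_rest (r : nat -> V) (l : list V) : Prop :=
  NoDup l /\ Sorted adj l /\
  exists i l0, l = r i :: l0 /\ forall k, i < k -> ~ In (r k) l.

Lemma path_truncated_at_last_visit r l q m : Injective r ->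
  NoDup (r m :: q ++ l) -> Sorted adj (r m :: q ++ l) -> (forall k, m <= k -> ~ In (r k) l) ->
  exists q', q' <> [] /\ path_avoiding_rest r (q' ++ l).
Proof.
  intros Ir Hnd Hs Hl. rewrite app_comm_cons in Hnd, Hs.
  assert (Hfin : finite_pred (fun v => In v ((r m :: q) ++ l))) by (eexists; eauto).
  destruct (injective_eventually_outside r _ Ir Hfin) as [M HM].
  destruct (bounded_has_last (fun k => In (r k) ((r m :: q) ++ l)) m M)
    as [k [Hk [Hrk Hlast]]]; [now left|exact HM|].
  apply in_app_or in Hrk. destruct Hrk as [Hrk|Hrk]; [|now destruct (Hl k)].
  apply in_split in Hrk. destruct Hrk as [l1 [l2 E]]. rewrite E, <- app_assoc in Hnd, Hs, Hlast.
  exists (r k :: l2). split; [discriminate|]. split; [|split].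
  - now apply NoDup_app_remove_l in Hnd.
  - now apply Sorted_app_r in Hs.
  - exists k, (l2 ++ l). split; [reflexivity|]. intros n Hn Hin. apply (Hlast n Hn).
    apply in_or_app. now right.
Qed.

Lemma path_avoiding_rest_extends a b l : ray arc a -> ray arc b -> inseparable a b ->
  path_avoiding_rest a l -> exists q, q <> [] /\ path_avoiding_rest b (q ++ l).
Proof.
  intros [Ia Aa] [Ib _] Hab [Hnd [Hs [i [l0 [El Hi]]]]].
  destruct (injective_eventually_outside b (fun v => In v l) Ib) as [N HN]; [now exists l|].
  destruct (Hab (l ++ map a (seq 0 (S i)) ++ map b (seq 0 N))) as [j [m [Hj [Hm Hjm]]]].
  rewrite !in_app_iff in Hj, Hm.
  assert (Hij : i < j).
  { apply Nat.nle_gt. intros K. apply Hj. right. left. apply in_map, in_seq. lia. }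
  assert (HNm : N <= m).
  { apply Nat.nlt_ge. intros K. apply Hm. right. right. apply in_map, in_seq. lia. }
  set (off_l := fun x y => adj x y /\ ~ In y l).
  assert (Halong : clos_refl_trans V off_l (a (S i)) (a j)).
  { clear - Hij Hi Aa. induction Hij as [|j Hij IH]; [apply rt_refl|].
    apply rt_trans with (a j); auto. apply rt_step. now split; auto. }
  assert (Hacross : clos_refl_trans V off_l (a j) (b m)).
  { apply rt_mono with (2 := Hjm). intros x y [_ [Hy Hxy]]. rewrite in_app_iff in Hy.
    split; auto. }
  destruct (simple_path_extends adj (adj_sym arc) l (a (S i)) (b m)) as [q [Hqnd Hqs]].
  - constructor; auto.
  - constructor; auto. rewrite El. constructor. now apply adj_sym.
  - now apply rt_trans with (a j).
  - destruct (path_truncated_at_last_visit b l q m) as [q' [Hq' Hpath]]; auto.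
    + intros k Hk. apply HN. lia.
    + eauto.
Qed.

(* Extend a path alternately to [a] and to [b], always avoiding the later vertices of the ray just
   reached; the union of these paths is a ray meeting both. *)
Lemma inseparable_rays_equiv a b : ray arc a -> ray arc b -> inseparable a b ->
  ray_equiv arc a b.
Proof.
  intros Ra Rb Hab.
  set (target := fun n => if Nat.even n then a else b).
  destruct (dependent_choice (fun n => path_avoiding_rest (target n))
    (fun l l' => exists q, q <> [] /\ l' = q ++ l) [a 0]) as [st [E0 Hst]].
  - split; [repeat constructor; auto|]. split; [repeat constructor|].
    exists 0, []. split; auto. intros k Hk [E|[]]. apply (proj1 Ra) in E. lia.
  - intros n l Hl.
    destruct (path_avoiding_rest_extends (target n) (target (S n)) l) as [q [Hq Hql]]; auto;
      try (unfold target; rewrite ?Nat.even_succ, <- ?Nat.negb_even;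
           destruct (Nat.even n); simpl; auto using inseparable_sym; fail).
    exists (q ++ l). eauto.
  - destruct (growing_paths_limit adj (adj_sym arc) st) as [s [Is [As Hs]]].
    + now rewrite E0.
    + intros n. destruct (Hst n) as [[Hnd [Hsorted _]] _]. auto.
    + intros n. apply Hst.
    + assert (Hmeet : forall n, exists k j, n <= k /\ s k = target n j).
      { intros n. destruct (Hst n) as [[_ [_ [j [l0 [E _]]]]] _], (Hs n) as [k [Hk Ek]].
        rewrite E in Ek. injection Ek as Ek. eauto. }
      exists s. split; [split; auto|]. split; intros N.
      * destruct (Hmeet (2 * N)) as [k [j [Hk E]]]. exists k, j. split; [lia|].
        unfold target in E. now rewrite Nat.even_mul in E.
      * destruct (Hmeet (S (2 * N))) as [k [j [Hk E]]]. exists k, j. split; [lia|].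
        unfold target in E. now rewrite Nat.even_succ, <- Nat.negb_even, Nat.even_mul in E.
Qed.

End InseparableRays.

(** * Cuts with finite boundary *)

Definition boundary {V : Type} (arc : V -> V -> Prop) (X : V -> Prop) (x : V) : Prop :=
  exists y, adj arc x y /\ ~ (X x <-> X y).

Definition boundary_within {V : Type} (arc : V -> V -> Prop) (n : nat) (x : V) (X : V -> Prop) :
  Prop := forall v, boundary arc X v -> ball arc n x v.

Section Boundary.

Context {V : Type} (arc : V -> V -> Prop).
Notation adj := (adj arc).
Notation boundary := (boundary arc).
Notation ball := (ball arc).

Lemma crossing_boundary X x y : adj x y -> X x -> ~ X y -> boundary X x /\ boundary X y.
Proof. intros Hxy Hx Hy. split; [exists y|exists x]; split; auto using adj_sym; tauto. Qed.

Lemma boundary_compl X v : boundary (compl X) v <-> boundary X v.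
Proof. unfold boundary, compl. split; intros [y [Hy H]]; exists y; tauto. Qed.

Lemma boundary_or X Y v : boundary (fun u => X u \/ Y u) v -> boundary X v \/ boundary Y v.
Proof.
  intros [y [Hy H]]. destruct (classic (X v <-> X y)); [right|left]; exists y; tauto.
Qed.

Lemma boundary_symmetric_difference X Y v :
  boundary (fun u => ~ (X u <-> Y u)) v -> boundary X v \/ boundary Y v.
Proof.
  intros [y [Hy H]]. destruct (classic (X v <-> X y)); [right|left]; exists y; tauto.
Qed.

Lemma boundary_automorphism g X v : automorphism arc g ->
  boundary (fun u => X (g u)) v -> boundary X (g v).
Proof. intros Hg [y [Hy H]]. exists (g y). now rewrite automorphism_adj. Qed.

Lemma finite_boundary_compl X : finite_pred (boundary X) -> finite_pred (boundary (compl X)).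
Proof. apply finite_subset. intros v. apply boundary_compl. Qed.

Lemma finite_boundary_automorphism g X : automorphism arc g ->
  finite_pred (boundary X) -> finite_pred (boundary (fun v => X (g v))).
Proof.
  intros Hg HX. apply finite_subset with (B := fun v => boundary X (g v)).
  - intros v. now apply boundary_automorphism.
  - apply finite_preimage; auto. now apply automorphism_injective with arc.
Qed.

Lemma boundary_within_compl n x X : boundary_within arc n x X -> boundary_within arc n x (compl X).
Proof. intros H v Hv. now apply H, boundary_compl. Qed.

Lemma boundary_within_automorphism g n x X : automorphism arc g ->
  boundary_within arc n (g x) X -> boundary_within arc n x (fun v => X (g v)).
Proof.
  intros Hg H v Hv. apply (automorphism_ball arc g); auto. now apply H, boundary_automorphism.
Qed.

Lemma ball_on_one_side n x X : (forall v, ball n x v -> ~ boundary X v) ->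
  forall y z, ball n x y -> ball n x z -> X y -> X z.
Proof.
  intros HX y z Hy Hz. apply (rt_invariant (adj_in arc (ball n x))).
  - intros a b Xa [Ha [Hb Hab]]. apply NNPP. intros Xb.
    now apply (HX a Ha), (crossing_boundary X a b).
  - now apply ball_induced_connected.
Qed.

(* A point of [Y] outside [X] could never leave [Y \ X]: its exits lie in the two balls, which
   are inside [X] and outside [Y] respectively. *)
Lemma nested_cuts m n x y X Y : connected arc ->
  boundary_within arc m x X -> boundary_within arc n y Y ->
  (forall u, ball m x u -> ball n y u -> False) ->
  X y -> ~ Y x -> forall v, Y v -> X v.
Proof.
  intros Hconn HX HY Hdisj Xy Yx.
  assert (X_ball : forall u, ball n y u -> X u).
  { intros u Hu. apply (ball_on_one_side n y X) with y; auto using ball_center.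
    intros v Hv Hb. now apply (Hdisj v (HX v Hb)). }
  assert (Y_ball : forall u, ball m x u -> ~ Y u).
  { intros u Hu Yu. apply Yx. apply (ball_on_one_side m x Y) with u; auto using ball_center.
    intros v Hv Hb. now apply (Hdisj v Hv), HY. }
  intros v Yv. apply NNPP. intros Xv.
  enough (Y y /\ ~ X y) by tauto.
  apply (connected_invariant arc (fun t => Y t /\ ~ X t) Hconn) with v; auto.
  intros s t [Ys Xs] Hst. split.
  - apply NNPP. intros Yt. now apply Xs, X_ball, HY, (crossing_boundary Y s t).
  - intros Xt. apply (Y_ball s); auto.
    apply HX, (crossing_boundary X t s); auto using adj_sym.
Qed.

Lemma ray_on_one_side r X : ray arc r -> finite_pred (boundary X) ->
  eventually_in r X \/ eventually_in r (compl X).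
Proof.
  intros [Ir Ar] HX. destruct (injective_eventually_outside r _ Ir HX) as [N HN].
  destruct (classic (X (r N))) as [H|H]; [left|right]; exists N; intros n Hn.
  - induction Hn as [|n Hn IH]; auto. apply NNPP. intros K.
    now apply (HN n Hn), (crossing_boundary X (r n) (r (S n))).
  - induction Hn as [|n Hn IH]; auto. intros K.
    apply (HN n Hn), (crossing_boundary X (r (S n)) (r n)); auto using adj_sym.
Qed.

Lemma meets_inf_common_side (s r : nat -> V) X : Injective s -> meets_inf s r ->
  eventually_in s X -> eventually_in r (compl X) -> False.
Proof.
  intros Is Hmeet Hs [M HM].
  assert (Hfin : finite_pred (fun v => exists m, m < M /\ r m = v)).
  { exists (map r (seq 0 M)). intros v [m [Hm <-]]. apply in_map, in_seq. lia. }
  destruct (eventually_in_and s _ _ Hs (injective_eventually_outside s _ Is Hfin)) as [N HN].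
  destruct (Hmeet N) as [n [m [Hn E]]]. destruct (HN n Hn) as [HX Hlate].
  apply (HM m); [|now rewrite <- E].
  apply Nat.nlt_ge. intros Hlt. apply Hlate. eauto.
Qed.

Lemma ray_equiv_common_side (a b : nat -> V) X : ray_equiv arc a b -> finite_pred (boundary X) ->
  eventually_in a X -> ~ eventually_in b (compl X).
Proof.
  intros [s [Rs [Hsa Hsb]]] HX Ha Hb. destruct (ray_on_one_side s X Rs HX) as [Hs|Hs].
  - exact (meets_inf_common_side s b X (proj1 Rs) Hsb Hs Hb).
  - apply (meets_inf_common_side s a (compl X) (proj1 Rs) Hsa Hs).
    now rewrite compl_involutive.
Qed.

Lemma component_boundary F a : locally_finite arc ->
  finite_pred (boundary (clos_refl_trans V (adj_in arc (fun v => ~ In v F)) a)).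
Proof.
  intros Hlf. apply finite_subset with (B := fun v => exists f, In f F /\ ball 1 f v).
  - assert (Hstep : forall x y, adj x y -> ~ In x F -> ~ In y F ->
      (clos_refl_trans V (adj_in arc (fun v => ~ In v F)) a x <->
       clos_refl_trans V (adj_in arc (fun v => ~ In v F)) a y)).
    { intros x y Hxy Hx Hy. split; intros H; (eapply rt_trans; [exact H|]); apply rt_step;
        repeat split; auto using adj_sym. }
    intros x [y [Hxy H]]. apply NNPP. intros Hno. apply H, Hstep; auto; intros HF; apply Hno.
    + exists x. split; auto. apply ball_center.
    + exists y. split; auto. right. exists y. split; [reflexivity|]. now apply adj_sym.
  - apply finite_bigunion; [now exists F|]. intros f _. now apply finite_ball.
Qed.

Lemma inequivalent_rays_separated a b : locally_finite arc -> ray arc a -> ray arc b ->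
  ~ ray_equiv arc a b ->
  exists E, finite_pred (boundary E) /\ eventually_in a E /\ eventually_in b (compl E).
Proof.
  intros Hlf Ra Rb Hab. apply NNPP. intros Hno. apply Hab, inseparable_rays_equiv; auto.
  intros F.
  destruct (injective_eventually_outside a (fun v => In v F) (proj1 Ra)) as [N HN]; [now exists F|].
  destruct (injective_eventually_outside b (fun v => In v F) (proj1 Rb)) as [M HM]; [now exists F|].
  set (E := clos_refl_trans V (adj_in arc (fun v => ~ In v F)) (a N)).
  apply NNPP. intros Hsep. apply Hno. exists E. split; [now apply component_boundary|]. split.
  - exists N. intros n Hn. induction Hn as [|n Hn IH]; [apply rt_refl|].
    apply rt_trans with (a n); auto. apply rt_step.
    repeat split; [apply HN|apply HN|apply Ra]; auto.
  - exists M. intros n Hn En. apply Hsep. exists N, n.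
    repeat split; [now apply HN|now apply HM|exact En].
Qed.

End Boundary.

(** * Cuts of a two-ended vertex-transitive graph *)

Section TwoEnded.

Context {V : Type} (arc : V -> V -> Prop).
Hypothesis arc_connected : connected arc.
Hypothesis arc_locally_finite : locally_finite arc.
Hypothesis arc_transitive : vertex_transitive arc.
Notation boundary := (boundary arc).
Notation ball := (ball arc).

Lemma ray_automorphism g r : automorphism arc g -> ray arc r -> ray arc (fun n => g (r n)).
Proof.
  intros Hg [Hinj Hadj]. split.
  - intros m n E. now apply Hinj, (automorphism_injective arc g Hg).
  - intros n. now apply automorphism_adj.
Qed.

Section TwoRays.

Variables (a b : nat -> V) (E : V -> Prop).
Hypothesis ray_a : ray arc a.
Hypothesis ray_b : ray arc b.
Hypothesis E_boundary : finite_pred (boundary E).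
Hypothesis a_in_E : eventually_in a E.
Hypothesis b_outside_E : eventually_in b (compl E).

(* An automorphism moves [E] far into [Y]; then one of its two sides lies inside [Y]. *)
Lemma infinite_region_contains_ray Y : finite_pred (boundary Y) -> ~ finite_pred Y ->
  exists r, ray arc r /\ eventually_in r Y.
Proof.
  intros HY Yinf. set (x := a 0).
  destruct (finite_in_ball arc _ x arc_connected E_boundary) as [n Hn].
  destruct (finite_in_ball arc _ x arc_connected HY) as [m Hm].
  destruct (infinite_outside_ball arc Y (m + n) x arc_locally_finite Yinf) as [y [Yy Hfar]].
  destruct (arc_transitive y x) as [g [Hg Hgy]].
  assert (E_moved : boundary_within arc n y (fun v => E (g v))).
  { apply boundary_within_automorphism; auto. now rewrite Hgy. }
  assert (Hside : forall Z r, ray arc r -> eventually_in r Z ->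
    boundary_within arc n y (fun v => Z (g v)) -> ~ Z (g x) ->
    exists r, ray arc r /\ eventually_in r Y).
  { intros Z r Rr HrZ HZb Zx. destruct (automorphism_inverse arc g Hg) as [h [Hh [_ Hgh]]].
    exists (fun k => h (r k)). split; [now apply ray_automorphism|].
    destruct HrZ as [N HN]. exists N. intros k Hk.
    apply (nested_cuts arc m n x y Y (fun v => Z (g v))); auto.
    - intros u Hx Hy. apply Hfar, ball_add with u; auto. now apply ball_sym.
    - rewrite Hgh. auto. }
  destruct (classic (E (g x))) as [Hx|Hx].
  - apply (Hside (compl E) b); auto. now apply (boundary_within_compl arc n y (fun v => E (g v))).
  - now apply (Hside E a).
Qed.

Hypothesis two_ends : forall r, ray arc r -> ray_equiv arc r a \/ ray_equiv arc r b.

Lemma region_without_ends_finite Y : finite_pred (boundary Y) ->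
  eventually_in a (compl Y) -> eventually_in b (compl Y) -> finite_pred Y.
Proof.
  intros HY Ha Hb. apply NNPP. intros Yinf.
  destruct (infinite_region_contains_ray Y HY Yinf) as [r [Rr Hr]].
  destruct (two_ends r Rr) as [Hequiv|Hequiv];
    now apply (ray_equiv_common_side arc r _ Y Hequiv HY Hr).
Qed.

Lemma separating_cuts_commensurable X : finite_pred (boundary X) ->
  eventually_in a X -> eventually_in b (compl X) -> commensurable X E.
Proof.
  intros HX Xa Xb. apply region_without_ends_finite.
  - apply finite_subset with (2 := finite_union _ _ HX E_boundary).
    apply boundary_symmetric_difference.
  - apply eventually_in_sub with (2 := eventually_in_and _ _ _ Xa a_in_E). unfold compl. tauto.
  - apply eventually_in_sub with (2 := eventually_in_and _ _ _ Xb b_outside_E).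
    unfold compl. tauto.
Qed.

Lemma infinite_cuts_commensurable X : finite_pred (boundary X) -> ~ finite_pred X ->
  ~ finite_pred (compl X) -> commensurable X E \/ commensurable X (compl E).
Proof.
  intros HX Xinf Xcoinf.
  assert (HX' : finite_pred (boundary (compl X))) by now apply finite_boundary_compl.
  destruct (ray_on_one_side arc a X ray_a HX) as [Xa|Xa],
           (ray_on_one_side arc b X ray_b HX) as [Xb|Xb].
  - exfalso. apply Xcoinf, region_without_ends_finite; rewrite ?compl_involutive; auto.
  - left. now apply separating_cuts_commensurable.
  - right. apply commensurable_compl_l, separating_cuts_commensurable; auto.
    now rewrite compl_involutive.
  - exfalso. apply Xinf, region_without_ends_finite; auto.
Qed.

End TwoRays.

Lemma two_ended_cut : has_exactly_two_ends arc -> exists E : V -> Prop,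
  finite_pred (boundary E) /\ ~ finite_pred E /\ ~ finite_pred (compl E) /\
  forall X, finite_pred (boundary X) -> ~ finite_pred X -> ~ finite_pred (compl X) ->
    commensurable X E \/ commensurable X (compl E).
Proof.
  intros [a [b [Ra [Rb [Hab Hends]]]]].
  destruct (inequivalent_rays_separated arc a b) as [E [HE [Ea Eb]]]; auto.
  exists E. repeat split; auto.
  - exact (eventually_in_infinite a E (proj1 Ra) Ea).
  - exact (eventually_in_infinite b _ (proj1 Rb) Eb).
  - now apply (infinite_cuts_commensurable a b).
Qed.

End TwoEnded.

(** * The height cocycle *)

Section Sides.

Context {V : Type} (arc : V -> V -> Prop).
Hypothesis arc_connected : connected arc.
Hypothesis arc_locally_finite : locally_finite arc.
Variable R : nat.
Notation ball := (ball arc).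
Notation boundary_within := (boundary_within arc R).

Definition uniform_cut (X : V -> Prop) : Prop :=
  ~ finite_pred X /\ ~ finite_pred (compl X) /\
  forall x, exists Y, commensurable Y X /\ boundary_within x Y.

(* [side X x] and [side (compl X) x] cover the graph but are not disjoint: both contain [x] when
   [R] is positive. *)
Definition side (X : V -> Prop) (x v : V) : Prop :=
  exists Y, commensurable Y X /\ boundary_within x Y /\ Y v.

Definition far_apart (x y : V) : Prop := forall u, ball R x u -> ball R y u -> False.

Lemma uniform_cut_compl X : uniform_cut X -> uniform_cut (compl X).
Proof.
  intros [Xinf [Xcoinf Hcut]]. split; [|split]; auto; [now rewrite compl_involutive|].
  intros x. destruct (Hcut x) as [Y [HYX HY]]. exists (compl Y).
  split; [now apply commensurable_compl|now apply boundary_within_compl].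
Qed.

Lemma far_apart_sym x y : far_apart x y -> far_apart y x.
Proof. unfold far_apart. eauto. Qed.

Lemma far_apart_outside_ball x y : ~ ball (R + R) x y -> far_apart x y.
Proof. intros H u Hx Hy. apply H, ball_add with u; auto. now apply ball_sym. Qed.

Lemma far_cuts_nested X x y Y Z : uniform_cut X -> far_apart x y ->
  commensurable Y X -> boundary_within x Y -> Y y ->
  commensurable Z X -> boundary_within y Z -> (forall v, Z v -> Y v) /\ ~ Z x.
Proof.
  intros [_ [Xcoinf _]] Hfar HYX HY Yy HZX HZ.
  enough (Zx : ~ Z x) by (split; auto; now apply (nested_cuts arc R R x y)).
  intros Zx. apply Xcoinf, (commensurable_finite (compl Z)); [now apply commensurable_compl|].
  apply finite_subset with (2 := commensurable_trans _ _ _ HYX (commensurable_sym _ _ HZX)).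
  intros v Zv. enough (Y v) by firstorder.
  apply (nested_cuts arc R R x y Y (compl Z)); auto using boundary_within_compl.
Qed.

Lemma commensurable_side_sub X Y x v : commensurable X Y -> side X x v -> side Y x v.
Proof.
  intros HXY [Z [HZX HZ]]. exists Z. split; auto. now apply commensurable_trans with X.
Qed.

(* The cuts at [x] are all contained in one cut around a point far away on the other side. *)
Lemma side_commensurable X x : uniform_cut X -> commensurable (side X x) X.
Proof.
  intros HX. pose proof HX as [_ [Xcoinf Hcut]]. destruct (Hcut x) as [Y [HYX HY]].
  destruct (infinite_outside_ball arc (compl Y) (R + R) x) as [y [Yy Hfar]]; auto.
  { intros K. apply Xcoinf, (commensurable_finite (compl Y)); auto.
    now apply commensurable_compl. }
  apply far_apart_outside_ball in Hfar. destruct (Hcut y) as [Z [HZX HZ]].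
  destruct (far_cuts_nested (compl X) x y (compl Y) (compl Z)) as [_ Zx];
    auto using uniform_cut_compl, commensurable_compl, boundary_within_compl.
  apply NNPP in Zx. apply commensurable_trans with Y; auto. apply commensurable_sym.
  apply commensurable_sandwich with Z.
  - apply commensurable_trans with X; auto using commensurable_sym.
  - intros v Hv. now exists Y.
  - intros v [T [HTX [HT Tv]]].
    apply (far_cuts_nested X y x Z T); auto using far_apart_sym.
Qed.

Lemma side_cover X x v : uniform_cut X -> side X x v \/ side (compl X) x v.
Proof.
  intros [_ [_ Hcut]]. destruct (Hcut x) as [Y [HYX HY]].
  destruct (classic (Y v)) as [Hv|Hv]; [left; now exists Y|right]. exists (compl Y).
  split; [now apply commensurable_compl|]. split; auto. now apply boundary_within_compl.
Qed.

Lemma side_automorphism g X x v : automorphism arc g ->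
  side X (g x) (g v) -> side (fun u => X (g u)) x v.
Proof.
  intros Hg [Y [HYX [HY Yv]]]. exists (fun u => Y (g u)). split; [|split]; auto.
  - apply commensurable_preimage; auto. now apply automorphism_injective with arc.
  - now apply boundary_within_automorphism.
Qed.

Lemma side_automorphism_iff g X x v : automorphism arc g ->
  (side X (g x) (g v) <-> side (fun u => X (g u)) x v).
Proof.
  intros Hg. split; [now apply side_automorphism|]. intros H.
  destruct (automorphism_inverse arc g Hg) as [h [Hh [Hhg Hgh]]].
  rewrite <- (Hhg x), <- (Hhg v) in H. apply (side_automorphism h) in H; auto.
  replace X with (fun u => X (g (h u))); auto.
  apply functional_extensionality. intros u. now rewrite Hgh.
Qed.

Lemma far_side_sub X x y : uniform_cut X -> far_apart x y -> side X x y ->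
  (forall v, side X y v -> side X x v) /\ ~ side X y x.
Proof.
  intros HX Hfar [Y [HYX [HY Yy]]].
  assert (Hnest := fun Z => far_cuts_nested X x y Y Z HX Hfar HYX HY Yy). split.
  - intros v [Z [HZX [HZ Zv]]]. exists Y. split; [|split]; auto. now apply (Hnest Z).
  - intros [Z [HZX [HZ Zx]]]. now apply (Hnest Z).
Qed.

Lemma far_opposite_side_sup X x y : uniform_cut X -> far_apart x y -> side X x y ->
  forall v, side (compl X) x v -> side (compl X) y v.
Proof.
  intros HX Hfar Hy. destruct (far_side_sub X x y HX Hfar Hy) as [_ Hx].
  destruct (side_cover X y x HX) as [|Hx']; [contradiction|].
  apply far_side_sub; auto using uniform_cut_compl, far_apart_sym.
Qed.

Open Scope Z_scope.

Definition indicator (P : Prop) : Z := if dec P then 1 else 0.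

Definition side_weight (X : V -> Prop) (x v : V) : Z :=
  indicator (side X x v) - indicator (side (compl X) x v).

Definition displacement (X : V -> Prop) (x y : V) : Z :=
  fsum (fun v => side_weight X x v - side_weight X y v).

Lemma indicator_true (P : Prop) : P -> indicator P = 1.
Proof. unfold indicator. destruct (dec P); tauto. Qed.

Lemma indicator_false (P : Prop) : ~ P -> indicator P = 0.
Proof. unfold indicator. destruct (dec P); tauto. Qed.

Lemma indicator_le (P Q : Prop) : (P -> Q) -> indicator P <= indicator Q.
Proof. unfold indicator. destruct (dec P), (dec Q); try lia. tauto. Qed.

Lemma indicator_iff (P Q : Prop) : (P <-> Q) -> indicator P = indicator Q.
Proof. unfold indicator. destruct (dec P), (dec Q); tauto. Qed.

Lemma side_weight_compl X x v : side_weight (compl X) x v = - side_weight X x v.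
Proof. unfold side_weight. rewrite compl_involutive. lia. Qed.

Lemma side_weight_commensurable X Y x v : commensurable X Y ->
  side_weight X x v = side_weight Y x v.
Proof.
  intros HXY. unfold side_weight.
  rewrite (indicator_iff (side X x v) (side Y x v)),
    (indicator_iff (side (compl X) x v) (side (compl Y) x v)); auto.
  - split; apply commensurable_side_sub; auto using commensurable_compl, commensurable_sym.
  - split; apply commensurable_side_sub; auto using commensurable_sym.
Qed.

Lemma side_weight_automorphism g X x v : automorphism arc g ->
  side_weight X (g x) (g v) = side_weight (fun u => X (g u)) x v.
Proof.
  intros Hg. unfold side_weight.
  rewrite (indicator_iff _ _ (side_automorphism_iff g X x v Hg)),
    (indicator_iff _ _ (side_automorphism_iff g (compl X) x v Hg)). reflexivity.
Qed.

Lemma side_weight_difference_finite X x y : uniform_cut X ->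
  finite_support (fun v => side_weight X x v - side_weight X y v).
Proof.
  assert (Hside : forall X, uniform_cut X -> commensurable (side X x) (side X y)).
  { intros Y HY. apply commensurable_trans with Y; auto using side_commensurable.
    now apply commensurable_sym, side_commensurable. }
  intros HX.
  apply finite_subset with
    (2 := finite_union _ _ (Hside X HX) (Hside (compl X) (uniform_cut_compl X HX))).
  intros v Hv. apply NNPP. intros Hno. apply Hv. unfold side_weight.
  rewrite (indicator_iff (side X x v) (side X y v)),
    (indicator_iff (side (compl X) x v) (side (compl X) y v)) by tauto. lia.
Qed.

Lemma displacement_add X x y z : uniform_cut X ->
  displacement X x z = displacement X x y + displacement X y z.
Proof.
  intros HX. unfold displacement.
  rewrite <- fsum_add by now apply side_weight_difference_finite.
  f_equal. apply functional_extensionality. intros v. lia.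
Qed.

Lemma displacement_compl X x y : uniform_cut X ->
  displacement (compl X) x y = - displacement X x y.
Proof.
  intros HX. unfold displacement. rewrite <- fsum_opp by now apply side_weight_difference_finite.
  f_equal. apply functional_extensionality. intros v. rewrite !side_weight_compl. lia.
Qed.

Lemma displacement_commensurable X Y x y : commensurable X Y ->
  displacement X x y = displacement Y x y.
Proof.
  intros HXY. unfold displacement. f_equal. apply functional_extensionality. intros v.
  now rewrite !(side_weight_commensurable X Y).
Qed.

Lemma displacement_automorphism g X x y : automorphism arc g -> uniform_cut X ->
  displacement X (g x) (g y) = displacement (fun v => X (g v)) x y.
Proof.
  intros Hg HX. unfold displacement.
  rewrite <- (fsum_bijective _ g (proj1 Hg)) by now apply side_weight_difference_finite.
  f_equal. apply functional_extensionality. intros v. now rewrite !side_weight_automorphism.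
Qed.

Hypothesis R_positive : (1 <= R)%nat.

Lemma side_center X x : uniform_cut X -> side X x x.
Proof.
  intros [_ [_ Hcut]]. destruct (Hcut x) as [Y [HYX HY]].
  exists (fun v => Y v \/ v = x). split; [|split]; auto.
  - apply commensurable_trans with Y; auto.
    apply finite_subset with (2 := finite_singleton x). intros v. tauto.
  - intros v Hv. apply boundary_or in Hv. destruct Hv as [Hv|[y [Hvy H]]]; auto.
    apply ball_mono with 1%nat; auto. destruct (classic (v = x)) as [->|Hne]; [apply ball_center|].
    right. exists x. split; [reflexivity|]. replace x with y by tauto. now apply adj_sym.
Qed.

Lemma displacement_far_pos X x y : uniform_cut X -> far_apart x y -> side X x y ->
  0 < displacement X x y.
Proof.
  intros HX Hfar Hy. destruct (far_side_sub X x y HX Hfar Hy) as [Hsub Hx].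
  pose proof (far_opposite_side_sup X x y HX Hfar Hy) as Hsup.
  apply fsum_pos with x; [now apply side_weight_difference_finite| |].
  - intros v. unfold side_weight.
    pose proof (indicator_le _ _ (Hsub v)). pose proof (indicator_le _ _ (Hsup v)). lia.
  - assert (Hx' : side (compl X) x x) by now apply side_center, uniform_cut_compl.
    unfold side_weight. rewrite (indicator_false (side X y x)); auto.
    rewrite !indicator_true; auto using side_center. lia.
Qed.

Lemma displacement_far_nonzero X x y : uniform_cut X -> far_apart x y ->
  displacement X x y <> 0.
Proof.
  intros HX Hfar. destruct (side_cover X x y HX) as [Hy|Hy].
  - pose proof (displacement_far_pos X x y HX Hfar Hy). lia.
  - pose proof (displacement_far_pos (compl X) x y (uniform_cut_compl X HX) Hfar Hy) as H.
    rewrite displacement_compl in H; auto. lia.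
Qed.

End Sides.

Definition equivariant_up_to_sign {V : Type} (arc : V -> V -> Prop) (h : V -> Z) : Prop :=
  forall g, automorphism arc g -> exists e, (e = 1 \/ e = -1)%Z /\
    forall x y, (h (g y) - h (g x) = e * (h y - h x))%Z.

Definition finite_layers {V : Type} (h : V -> Z) : Prop :=
  forall k, finite_pred (fun v => h v = k).

Section TwoEndedHeight.

Context {V : Type} (arc : V -> V -> Prop).
Hypothesis arc_connected : connected arc.
Hypothesis arc_locally_finite : locally_finite arc.
Hypothesis arc_transitive : vertex_transitive arc.
Hypothesis arc_two_ended : has_exactly_two_ends arc.

Lemma two_ended_uniform_cut : exists R X, 1 <= R /\ uniform_cut arc R X /\
  forall g, automorphism arc g ->
    commensurable (fun v => X (g v)) X \/ commensurable (fun v => X (g v)) (compl X).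
Proof.
  destruct (two_ended_cut arc) as [E [HE [Einf [Ecoinf Hunique]]]]; auto.
  assert (Haut : forall g, automorphism arc g ->
    commensurable (fun v => E (g v)) E \/ commensurable (fun v => E (g v)) (compl E)).
  { intros g Hg. apply Hunique; [now apply finite_boundary_automorphism| |].
    - intros K. now apply Einf, (automorphism_preimage_finite arc g E).
    - intros K. now apply Ecoinf, (automorphism_preimage_finite arc g (compl E)). }
  destruct arc_two_ended as [r _].
  destruct (finite_in_ball arc _ (r 0) arc_connected HE) as [n Hn].
  exists (S n), E. split; [lia|]. split; [|exact Haut]. split; [|split]; auto.
  intros x. destruct (arc_transitive x (r 0)) as [g [Hg Hgx]].
  assert (Hb : boundary_within arc (S n) x (fun v => E (g v))).
  { apply boundary_within_automorphism; auto. intros v Hv. rewrite Hgx. left. now apply Hn. }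
  destruct (Haut g Hg) as [HgE|HgE].
  - now exists (fun v => E (g v)).
  - exists (compl (fun v => E (g v))). split; [|now apply boundary_within_compl].
    apply commensurable_sym, commensurable_compl_l. now apply commensurable_sym.
Qed.

Lemma two_ended_height : exists h, equivariant_up_to_sign arc h /\ finite_layers h.
Proof.
  destruct two_ended_uniform_cut as [R [X [HR [HX Haut]]]].
  destruct arc_two_ended as [r _]. set (x0 := r 0). exists (displacement arc R X x0).
  assert (Hdiff : forall x y,
    (displacement arc R X x0 y - displacement arc R X x0 x = displacement arc R X x y)%Z).
  { intros x y. rewrite (displacement_add arc arc_connected arc_locally_finite R X x0 x y HX).
    lia. }
  split.
  - intros g Hg. destruct (Haut g Hg) as [H|H].
    + exists 1%Z. split; [lia|]. intros x y.
      rewrite !Hdiff, displacement_automorphism, (displacement_commensurable _ _ _ _ x y H); auto.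
      lia.
    + exists (-1)%Z. split; [lia|]. intros x y.
      rewrite !Hdiff, displacement_automorphism, (displacement_commensurable _ _ _ _ x y H),
        displacement_compl; auto; lia.
  - intros k. destruct (classic (exists x, displacement arc R X x0 x = k)) as [[x Hx]|Hno].
    + apply finite_subset with (2 := finite_ball arc (R + R) x arc_locally_finite).
      intros v Hv. apply NNPP. intros Hfar. apply far_apart_outside_ball in Hfar.
      apply (displacement_far_nonzero arc arc_connected arc_locally_finite R HR X x v HX Hfar).
      rewrite <- Hdiff. lia.
    + apply finite_empty. eauto.
Qed.

End TwoEndedHeight.

Lemma two_ended_infinite {V : Type} (arc : V -> V -> Prop) :
  has_exactly_two_ends arc -> ~ finite_pred (fun _ : V => True).
Proof.
  intros [r [_ [[Hinj _] _]]]. apply (eventually_in_infinite r); auto. now exists 0.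
Qed.

Lemma two_ended_has_arc {V : Type} (arc : V -> V -> Prop) :
  has_exactly_two_ends arc -> exists x y, arc x y.
Proof. intros [r [_ [[_ Hr] _]]]. destruct (Hr 0) as [H|H]; eauto. Qed.

(** * Connected-homogeneous digraphs *)

Section Homogeneous.

Context {V : Type} (arc : V -> V -> Prop).
Hypothesis arc_digraph : is_digraph arc.
Hypothesis arc_homogeneous : connected_homogeneous arc.
Notation adj := (adj arc).

Lemma arc_irreflexive x : ~ arc x x.
Proof. apply (proj1 arc_digraph). Qed.

Lemma adj_irreflexive x : ~ adj x x.
Proof. intros [H|H]; now apply arc_irreflexive in H. Qed.

Lemma homogeneous_vertex_transitive : vertex_transitive arc.
Proof.
  intros x y.
  destruct (arc_homogeneous (fun v => v = x) (fun v => v = y) (fun _ => y)) as [g [Hg Hgx]];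
    auto using finite_singleton, induced_connected_singleton.
  - split; [auto|]. split; [congruence|]. split.
    + intros z ->. eauto.
    + intros a b -> ->. split; intros H; now apply arc_irreflexive in H.
  - eauto.
Qed.

Lemma homogeneous_move_vertex S u z z' :
  finite_pred S -> induced_connected arc S -> S u -> adj u z -> adj u z' -> ~ S z -> ~ S z' ->
  (forall s, S s -> (arc s z <-> arc s z')) -> (forall s, S s -> (arc z s <-> arc z' s)) ->
  exists g, automorphism arc g /\ (forall s, S s -> g s = s) /\ g z = z'.
Proof.
  intros Sfin Sconn Su Hz Hz' Sz Sz' Hout Hin.
  set (f := fun v => if dec (v = z) then z' else v).
  assert (fz : f z = z') by (unfold f; destruct (dec (z = z)); congruence).
  assert (fS : forall s, S s -> f s = s).
  { intros s Hs. unfold f. destruct (dec (s = z)); congruence. }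
  destruct (arc_homogeneous (fun v => S v \/ v = z) (fun v => S v \/ v = z') f) as [g [Hg Hgf]].
  - apply finite_union; auto using finite_singleton.
  - apply finite_union; auto using finite_singleton.
  - now apply induced_connected_add with u.
  - now apply induced_connected_add with u.
  - split; [|split; [|split]].
    + intros x [Hx| ->]; [rewrite fS; auto|auto].
    + intros x y [Hx| ->] [Hy| ->]; rewrite ?fz, ?fS; congruence.
    + intros y [Hy| ->]; [exists y|exists z]; auto.
    + intros x y [Hx| ->] [Hy| ->]; rewrite ?fz, ?fS; auto; [tauto|].
      split; intros H; now apply arc_irreflexive in H.
  - exists g. split; auto. split; [intros s Hs|]; rewrite Hgf; auto.
Qed.

Lemma homogeneous_extend_automorphism g S u z z' : automorphism arc g ->
  finite_pred S -> induced_connected arc S -> S u -> adj u z -> adj (g u) z' -> ~ S z ->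
  (forall s, S s -> g s <> z') -> (forall s, S s -> (arc s z <-> arc (g s) z')) ->
  (forall s, S s -> (arc z s <-> arc z' (g s))) ->
  exists k, automorphism arc k /\ (forall s, S s -> k s = g s) /\ k z = z'.
Proof.
  intros Hg Sfin Sconn Su Hz Hz' Sz Sz' Hout Hin.
  destruct (automorphism_inverse arc g Hg) as [h [Hh [Hhg Hgh]]].
  destruct (homogeneous_move_vertex S u z (h z')) as [k [Hk [HkS Hkz]]]; auto.
  - now rewrite <- (automorphism_adj arc g), Hgh.
  - intros Hs. now apply (Sz' (h z')).
  - intros s Hs. now rewrite Hout, <- (automorphism_arc arc g s), Hgh.
  - intros s Hs. now rewrite Hin, <- (automorphism_arc arc g _ s), Hgh.
  - exists (fun v => g (k v)). split; [|split].
    + destruct (proj1 Hk) as [k' [Hk'k Hkk']]. split.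
      * exists (fun v => k' (h v)). split; intros; congruence.
      * intros x y. now rewrite !automorphism_arc.
    + intros s Hs. now rewrite HkS.
    + now rewrite Hkz.
Qed.

Lemma homogeneous_arc_transitive x y x' y' : arc x y -> arc x' y' ->
  exists g, automorphism arc g /\ g x = x' /\ g y = y'.
Proof.
  intros Hxy Hxy'. destruct (homogeneous_vertex_transitive x x') as [g [Hg <-]].
  destruct (homogeneous_extend_automorphism g (fun v => v = x) x y y') as [k [Hk [Hkx Hky]]];
    auto using finite_singleton, induced_connected_singleton; try (now left).
  - intros ->. now apply arc_irreflexive in Hxy.
  - intros s -> E. rewrite <- E in Hxy'. now apply arc_irreflexive in Hxy'.
  - intros s ->. tauto.
  - intros s ->. split; intros H; exfalso; eapply (proj2 arc_digraph); eauto.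
  - exists k. auto.
Qed.

Lemma homogeneous_induced_path_transitive g x y z z' : automorphism arc g ->
  adj x y -> adj y z -> x <> z -> ~ adj x z -> adj (g y) z' -> g x <> z' -> ~ adj (g x) z' ->
  (arc y z <-> arc (g y) z') -> (arc z y <-> arc z' (g y)) ->
  exists k, automorphism arc k /\ k x = g x /\ k y = g y /\ k z = z'.
Proof.
  unfold Defs.adj. intros Hg Hxy Hyz Nxz Axz Hyz' Nxz' Axz' Hout Hin.
  destruct (homogeneous_extend_automorphism g (fun v => v = x \/ v = y) y z z')
    as [k [Hk [Hkxy Hkz]]]; auto.
  - apply finite_union; apply finite_singleton.
  - apply induced_connected_add with x; auto using induced_connected_singleton.
  - intros [->| ->]; [auto|]. now apply adj_irreflexive in Hyz.
  - intros s [->| ->]; [auto|]. intros <-. now apply adj_irreflexive in Hyz'.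
  - intros s [->| ->]; tauto.
  - intros s [->| ->]; tauto.
  - exists k. split; auto.
Qed.

Lemma homogeneous_two_arc_transitive x y z x' y' z' :
  arc x y -> arc y z -> ~ adj x z -> arc x' y' -> arc y' z' -> ~ adj x' z' ->
  exists g, automorphism arc g /\ g x = x' /\ g y = y' /\ g z = z'.
Proof.
  intros Hxy Hyz Axz Hxy' Hyz' Axz'.
  destruct (homogeneous_arc_transitive x y x' y') as [g [Hg [<- <-]]]; auto.
  pose proof (proj2 arc_digraph) as Hanti.
  apply homogeneous_induced_path_transitive; auto; try (now left).
  - intros ->. now apply (Hanti z y).
  - intros E. rewrite <- E in Hyz'. now apply (Hanti (g x) (g y)).
  - tauto.
  - split; intros H; exfalso; [now apply (Hanti y z)|now apply (Hanti (g y) z')].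
Qed.

Lemma homogeneous_siblings_transitive u x y u' x' y' :
  arc u x -> arc u y -> x <> y -> ~ adj x y ->
  arc u' x' -> arc u' y' -> x' <> y' -> ~ adj x' y' ->
  exists g, automorphism arc g /\ g u = u' /\ g x = x' /\ g y = y'.
Proof.
  intros Hx Hy Nxy Axy Hx' Hy' Nxy' Axy'.
  destruct (homogeneous_arc_transitive u x u' x') as [g [Hg [<- <-]]]; auto.
  pose proof (proj2 arc_digraph) as Hanti.
  destruct (homogeneous_induced_path_transitive g x u y y') as [k [Hk [Hkx [Hku Hky]]]]; auto;
    try (now left); try (now right).
  - tauto.
  - split; intros H; exfalso; [now apply (Hanti u y)|now apply (Hanti (g u) y')].
  - exists k. auto.
Qed.

Lemma homogeneous_in_neighbour : (exists x y, arc x y) -> forall y, exists x, arc x y.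
Proof.
  intros [a [b Hab]] y. destruct (homogeneous_vertex_transitive b y) as [g [Hg <-]].
  exists (g a). now apply automorphism_arc.
Qed.

Lemma homogeneous_out_neighbour : (exists x y, arc x y) -> forall x, exists y, arc x y.
Proof.
  intros [a [b Hab]] x. destruct (homogeneous_vertex_transitive a x) as [g [Hg <-]].
  exists (g b). now apply automorphism_arc.
Qed.

End Homogeneous.

(** * From a height function to a layering *)

Definition layering {V : Type} (arc : V -> V -> Prop) (h : V -> Z) : Prop :=
  (forall x y, arc x y -> h y = (h x + 1)%Z) /\ finite_layers h.

Section ConstantIncrement.

Context {V : Type} (arc : V -> V -> Prop) (h : V -> Z).
Hypothesis arc_connected : connected arc.
Notation adj := (adj arc).
Open Scope Z_scope.

Lemma constant_increment (x1 y1 : V) : arc x1 y1 ->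
  (forall y, exists x, arc x y) -> (forall x, exists y, arc x y) ->
  (forall x y z, arc x y -> arc y z -> h z - h y = h y - h x) ->
  forall x y, arc x y -> h y - h x = h y1 - h x1.
Proof.
  intros H1 Hin Hout Htwo. set (d := h y1 - h x1).
  set (P := fun v => (forall u, arc u v -> h v - h u = d) /\ (forall u, arc v u -> h u - h v = d)).
  assert (P_in : forall x y, arc x y -> h y - h x = d -> P y).
  { intros x y Hxy E.
    assert (Hyz : forall z, arc y z -> h z - h y = d) by (intros z Hz; now rewrite (Htwo x y z)).
    split; auto. intros u Hu. destruct (Hout y) as [z Hz]. rewrite <- (Htwo u y z); auto. }
  assert (P_out : forall y z, arc y z -> h z - h y = d -> P y).
  { intros y z Hyz E. destruct (Hin y) as [x Hx].
    apply (P_in x y); auto. now rewrite <- (Htwo x y z). }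
  assert (HP : forall v, P v).
  { intros v. apply (connected_invariant arc P arc_connected) with y1; [|now apply (P_in x1 y1)].
    intros a b [Pin Pout] [Hab|Hab]; [apply (P_in a b)|apply (P_out b a)]; auto. }
  intros x y. apply HP.
Qed.

Lemma two_valued_height x y : adj x y -> (forall w u v, adj w u -> adj w v -> h u = h v) ->
  forall v, h v = h x \/ h v = h y.
Proof.
  intros Hxy Hnbr v.
  set (P := fun v => (h v = h x /\ forall u, adj v u -> h u = h y) \/
                     (h v = h y /\ forall u, adj v u -> h u = h x)).
  assert (HP : P v); [|unfold P in HP; tauto].
  apply (connected_invariant arc P arc_connected) with x.
  - intros a b [[Ha Hu]|[Ha Hu]] Hab; [right|left]; (split; [auto|]); intros u Hbu;
      rewrite <- Ha; apply (Hnbr b); auto using adj_sym.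
  - left. split; auto. intros u Hu. now apply (Hnbr x).
Qed.

Lemma constant_increment_layering (x0 : V) (d : Z) : d <> 0 ->
  (forall x y, arc x y -> h y - h x = d) -> finite_layers h ->
  layering arc (fun v => (h v - h x0) / d).
Proof.
  intros Hd Harc Hfin.
  assert (Hmult : forall v, exists k, h v - h x0 = k * d).
  { intros v.
    apply (connected_invariant arc (fun v => exists k, h v - h x0 = k * d) arc_connected) with x0.
    - intros a b [k Hk] [H|H]; apply Harc in H; [exists (k + 1)|exists (k - 1)]; lia.
    - exists 0. lia. }
  split.
  - intros x y Hxy. destruct (Hmult x) as [k Hk].
    assert (Hk' : h y - h x0 = (k + 1) * d) by (pose proof (Harc _ _ Hxy); lia).
    now rewrite Hk, Hk', !Z.div_mul.
  - intros k. apply finite_subset with (2 := Hfin (h x0 + k * d)). intros v Hv.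
    destruct (Hmult v) as [k' Hk']. rewrite Hk', Z.div_mul in Hv; auto. subst. lia.
Qed.

End ConstantIncrement.

Section Layering.

Context {V : Type} (arc : V -> V -> Prop) (h : V -> Z).
Hypothesis arc_digraph : is_digraph arc.
Hypothesis arc_connected : connected arc.
Hypothesis arc_homogeneous : connected_homogeneous arc.
Hypothesis arc_exists : exists x y, arc x y.
Hypothesis V_infinite : ~ finite_pred (fun _ : V => True).
Hypothesis h_equivariant : equivariant_up_to_sign arc h.
Hypothesis h_finite : finite_layers h.
Notation adj := (adj arc).
Open Scope Z_scope.

Lemma arc_increments_abs x y x' y' : arc x y -> arc x' y' ->
  Z.abs (h y - h x) = Z.abs (h y' - h x').
Proof.
  intros Hxy Hxy'.
  destruct (homogeneous_arc_transitive arc arc_digraph arc_homogeneous x y x' y')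
    as [g [Hg [<- <-]]]; auto.
  destruct (h_equivariant g Hg) as [e [He ->]]. destruct He; subst e; lia.
Qed.

Lemma arc_increment_nonzero x y : arc x y -> h y <> h x.
Proof.
  intros Hxy E. apply V_infinite. apply finite_subset with (2 := h_finite (h x)). intros v _.
  apply (connected_invariant arc (fun v => h v = h x) arc_connected) with x; auto.
  intros a b Ha [H|H]; pose proof (arc_increments_abs _ _ _ _ Hxy H); lia.
Qed.

(* All increments along arcs are equal up to sign and nonzero: a triangle would violate parity. *)
Lemma two_arc_induced x y z : arc x y -> arc y z -> ~ adj x z.
Proof.
  intros Hxy Hyz Hxz. pose proof (arc_increments_abs _ _ _ _ Hxy Hyz).
  pose proof (arc_increment_nonzero _ _ Hxy).
  destruct Hxz as [H'|H']; pose proof (arc_increments_abs _ _ _ _ Hxy H'); lia.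
Qed.

Lemma two_arc_returns_transfer x y z x' y' z' :
  arc x y -> arc y z -> arc x' y' -> arc y' z' -> h z = h x -> h z' = h x'.
Proof.
  intros Hxy Hyz Hxy' Hyz' E.
  destruct (homogeneous_two_arc_transitive arc arc_digraph arc_homogeneous x y z x' y' z')
    as [g [Hg [<- [<- <-]]]]; eauto using two_arc_induced.
  destruct (h_equivariant g Hg) as [e [_ He]]. specialize (He x z). rewrite E in He. lia.
Qed.

(* If the height returned along one directed 2-path, it would return along all of them, and so
   take only two values. *)
Lemma two_arc_no_return x y z : arc x y -> arc y z -> h z <> h x.
Proof.
  intros Hxy Hyz E. apply V_infinite.
  apply finite_subset with (2 := finite_union _ _ (h_finite (h x)) (h_finite (h y))).
  intros v _. apply (two_valued_height arc h arc_connected); [now left|].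
  intros w. destruct (homogeneous_in_neighbour arc arc_digraph arc_homogeneous arc_exists w)
    as [a Ha], (homogeneous_out_neighbour arc arc_digraph arc_homogeneous arc_exists w) as [b Hb].
  assert (Hreturn : forall a b, arc a w -> arc w b -> h b = h a).
  { intros a' b' Ha' Hb'. now apply (two_arc_returns_transfer x y z a' w b'). }
  assert (Hw : forall u, adj w u -> h u = h a).
  { intros u [Hu|Hu]; [auto|]. rewrite <- (Hreturn u b), <- (Hreturn a b); auto. }
  intros u v' Hu Hv. now rewrite (Hw u), (Hw v').
Qed.

Lemma layering_exists : exists k, layering arc k.
Proof.
  destruct arc_exists as [x [y Hxy]].
  exists (fun v => (h v - h x) / (h y - h x)).
  apply constant_increment_layering; auto.
  - pose proof (arc_increment_nonzero x y Hxy). lia.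
  - apply constant_increment; auto using homogeneous_in_neighbour, homogeneous_out_neighbour.
    intros a b c Hab Hbc. pose proof (arc_increments_abs _ _ _ _ Hab Hbc).
    pose proof (two_arc_no_return a b c Hab Hbc). lia.
Qed.

End Layering.

(** * Twins in layered connected-homogeneous digraphs *)

Lemma bi_infinite_path {V : Type} (R : V -> V -> Prop) x :
  (forall x, exists y, R x y) -> (forall y, exists x, R x y) ->
  exists c : Z -> V, c 0%Z = x /\ forall i, R (c i) (c (i + 1)%Z).
Proof.
  intros Hout Hin. destruct (functional_choice _ Hout) as [s Hs].
  destruct (functional_choice (fun y x => R x y) Hin) as [p Hp].
  exists (fun i => if Z_le_gt_dec 0 i then Nat.iter (Z.to_nat i) s x
                   else Nat.iter (Z.to_nat (- i)) p x).
  split; [reflexivity|]. intros i.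
  destruct (Z_le_gt_dec 0 i), (Z_le_gt_dec 0 (i + 1)); try lia.
  - replace (Z.to_nat (i + 1)) with (S (Z.to_nat i)) by lia. apply Hs.
  - replace i with (-1)%Z by lia. apply Hp.
  - replace (Z.to_nat (- i)) with (S (Z.to_nat (- (i + 1)))) by lia. apply Hp.
Qed.

Definition in_twins {V : Type} (arc : V -> V -> Prop) (a b : V) : Prop :=
  forall w, arc w a <-> arc w b.

Definition out_twins {V : Type} (arc : V -> V -> Prop) (a b : V) : Prop :=
  forall w, arc a w <-> arc b w.

Section Twins.

Context {V : Type} (arc : V -> V -> Prop).

Lemma automorphism_in_twins g a b :
  automorphism arc g -> in_twins arc a b -> in_twins arc (g a) (g b).
Proof.
  intros Hg Hab w. destruct (automorphism_inverse arc g Hg) as [h [_ [_ Hgh]]].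
  rewrite <- (Hgh w), !automorphism_arc; auto.
Qed.

Lemma automorphism_fixing_parents_in_twins g v : automorphism arc g ->
  (forall w, arc w v -> g w = w) -> in_twins arc v (g v).
Proof.
  intros Hg Hfix w. split; intros Hw.
  - rewrite <- (Hfix w Hw). now apply automorphism_arc.
  - destruct (automorphism_inverse arc g Hg) as [h [_ [_ Hgh]]].
    rewrite <- (Hgh w), automorphism_arc in Hw; auto.
    rewrite <- (Hgh w). now rewrite (Hfix _ Hw).
Qed.

End Twins.

Section Layered.

Context {V : Type} (arc : V -> V -> Prop) (h : V -> Z).
Hypothesis arc_connected : connected arc.
Hypothesis arc_homogeneous : connected_homogeneous arc.
Hypothesis arc_layering : layering arc h.
Hypothesis arc_exists : exists x y, arc x y.
Notation adj := (adj arc).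
Open Scope Z_scope.

Let arc_height x y : arc x y -> h y = h x + 1 := proj1 arc_layering x y.

Lemma layering_digraph : is_digraph arc.
Proof.
  split.
  - intros x H. apply arc_height in H. lia.
  - intros x y Hxy Hyx. apply arc_height in Hxy, Hyx. lia.
Qed.

Lemma layering_locally_finite : locally_finite arc.
Proof.
  intros x. split.
  - apply finite_subset with (2 := proj2 arc_layering (h x + 1)). intros y. apply arc_height.
  - apply finite_subset with (2 := proj2 arc_layering (h x - 1)). intros y H.
    apply arc_height in H. lia.
Qed.

Let arc_digraph := layering_digraph.
Let arc_locally_finite := layering_locally_finite.
Let arc_transitive := homogeneous_vertex_transitive arc arc_digraph arc_homogeneous.
Let in_neighbour := homogeneous_in_neighbour arc arc_digraph arc_homogeneous arc_exists.
Let out_neighbour := homogeneous_out_neighbour arc arc_digraph arc_homogeneous arc_exists.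

Lemma siblings_nonadjacent u x y : arc u x -> arc u y -> ~ adj x y.
Proof. intros Hx Hy [H|H]; apply arc_height in Hx, Hy, H; lia. Qed.

Lemma automorphism_height g x y : automorphism arc g -> h (g y) - h (g x) = h y - h x.
Proof.
  intros Hg. enough (h (g y) - h y = h (g x) - h x) by lia.
  apply (connected_invariant arc (fun v => h (g v) - h v = h (g x) - h x) arc_connected) with x;
    auto.
  intros a b Ha [H|H]; pose proof (arc_height _ _ H); apply (automorphism_arc arc g) in H; auto;
    apply arc_height in H; lia.
Qed.

Lemma ball_height n x y : ball arc n x y -> h y <= h x + Z.of_nat n.
Proof.
  revert y. induction n as [|n IH]; intros y Hy.
  - simpl in Hy. subst. lia.
  - destruct Hy as [Hy|[z [Hz [H|H]]]]; [apply IH in Hy; lia| |];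
      apply IH in Hz; apply arc_height in H; lia.
Qed.

Lemma layer_nonempty k : exists v, h v = k.
Proof.
  pose proof arc_exists as [x _].
  destruct (bi_infinite_path arc x out_neighbour in_neighbour) as [c [<- Hc]].
  assert (H : forall i, h (c i) = h (c 0) + i).
  { intros i. induction i as [|i IH|i IH] using Z.peano_ind; [lia| |].
    - pose proof (arc_height _ _ (Hc i)). rewrite <- Z.add_1_r. lia.
    - pose proof (arc_height _ _ (Hc (Z.pred i))) as H.
      replace (Z.pred i + 1) with i in H by lia. lia. }
  exists (c (k - h (c 0))). rewrite H. lia.
Qed.

Lemma layer_automorphism k k' : exists g, automorphism arc g /\ forall v, h v = k -> h (g v) = k'.
Proof.
  destruct (layer_nonempty k) as [x Hx], (layer_nonempty k') as [y Hy].
  destruct (arc_transitive x y) as [g [Hg <-]]. exists g. split; auto.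
  intros v Hv. pose proof (automorphism_height g x v Hg). lia.
Qed.

Lemma layers_same_card : exists r, forall k, has_card (fun v => h v = k) r.
Proof.
  destruct (finite_enumerated _ (proj2 arc_layering 0)) as [l Hl].
  exists (length l). intros k. destruct (layer_automorphism 0 k) as [g [Hg Hgk]].
  apply has_card_bijection with (A := fun v => h v = 0) (f := g); [|now exists l].
  destruct (automorphism_inverse arc g Hg) as [g' [Hg' [_ Hgg']]]. split; [auto|]. split.
  - intros x y _ _. now apply automorphism_injective with arc.
  - intros y Hy. exists (g' y). split; auto. destruct (layer_nonempty 0) as [x Hx].
    pose proof (automorphism_height g x (g' y) Hg) as E. rewrite (Hgk x Hx), Hgg' in E. lia.
Qed.

Lemma layers_in_balls : exists n, forall x y, h y = h x -> ball arc n x y.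
Proof.
  pose proof arc_exists as [x0 _].
  destruct (finite_in_ball arc _ x0 arc_connected (proj2 arc_layering (h x0))) as [n Hn].
  exists n. intros x y Hxy. destruct (arc_transitive x x0) as [g [Hg Hgx]].
  apply (automorphism_ball arc g); auto. rewrite Hgx. apply Hn.
  pose proof (automorphism_height g x y Hg) as E. rewrite Hgx in E. lia.
Qed.

(* [S] is the ball together with the [m] layers above that of [x]. *)
Lemma layer_spanned_above n x : (forall y, h y = h x -> ball arc n x y) ->
  forall m : nat, exists S, finite_pred S /\ induced_connected arc S /\
    (forall v, h v = h x + Z.of_nat m -> S v) /\
    forall v, S v -> h v <= h x + Z.max (Z.of_nat n) (Z.of_nat m).
Proof.
  intros Hn. induction m as [|m [S [Sfin [Sconn [Slayer Sle]]]]].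
  - exists (ball arc n x). repeat split.
    + now apply finite_ball.
    + apply ball_induced_connected.
    + intros v Hv. apply Hn. lia.
    + intros v Hv. apply ball_height in Hv. lia.
  - exists (fun v => S v \/ h v = h x + Z.of_nat (Datatypes.S m)). repeat split; auto.
    + apply finite_union; auto. apply arc_layering.
    + apply induced_connected_union_neighbours; auto. intros v Hv.
      destruct (in_neighbour v) as [u Hu]. exists u. split; [|now left].
      apply Slayer. apply arc_height in Hu. lia.
    + intros v [Hv|Hv]; [apply Sle in Hv|]; lia.
Qed.

Lemma layer_spanned_from_below k : exists S, finite_pred S /\ induced_connected arc S /\
  (forall v, h v = k -> S v) /\ forall v, S v -> h v <= k.
Proof.
  destruct layers_in_balls as [n Hn], (layer_nonempty (k - Z.of_nat n)) as [x Hx].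
  destruct (layer_spanned_above n x (Hn x) n) as [S [Sfin [Sconn [Slayer Sle]]]].
  exists S. repeat split; auto.
  - intros v Hv. apply Slayer. lia.
  - intros v Hv. apply Sle in Hv. lia.
Qed.

(* Without distinct in-twins, an automorphism fixing a layer pointwise fixes everything above it;
   but homogeneity lets it exchange two children of a vertex on the next layer. *)
Lemma in_twins_exist u z z' : arc u z -> arc u z' -> z <> z' ->
  exists a b, a <> b /\ in_twins arc a b.
Proof.
  intros Hz Hz' Hne. apply NNPP. intros Hno.
  assert (Heq : forall a b, in_twins arc a b -> a = b).
  { intros a b Hab. apply NNPP. intros K. apply Hno. eauto. }
  destruct (layer_spanned_from_below (h u)) as [S [Sfin [Sconn [Slayer Sle]]]].
  destruct (out_neighbour u) as [t Hut].
  destruct (arc_transitive u t) as [g [Hg Hgu]].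
  assert (Ha : arc t (g z)) by (rewrite <- Hgu, automorphism_arc; auto).
  assert (Hb : arc t (g z')) by (rewrite <- Hgu, automorphism_arc; auto).
  pose proof (arc_height _ _ Hut) as Ht.
  pose proof (arc_height _ _ Ha) as Lz. pose proof (arc_height _ _ Hb) as Lz'.
  assert (Htop : forall v, h v = h t + 1 -> ~ (S v \/ v = t)).
  { intros v Hv [K| ->]; [apply Sle in K|]; lia. }
  destruct (homogeneous_move_vertex arc arc_digraph arc_homogeneous (fun v => S v \/ v = t) t
    (g z) (g z')) as [k [Hk [HkS Hkz]]]; auto; try (now left).
  - apply finite_union; auto using finite_singleton.
  - apply induced_connected_add with u; auto. now left.
  - intros s [Hs| ->]; [|tauto]. apply Sle in Hs. split; intros H; apply arc_height in H; lia.
  - intros s [Hs| ->]; [apply Sle in Hs|]; split; intros H; apply arc_height in H; lia.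
  - apply Hne, (automorphism_injective arc g Hg). rewrite <- Hkz.
    apply Heq, automorphism_fixing_parents_in_twins; auto. intros w Hw. symmetry.
    apply Heq, automorphism_fixing_parents_in_twins; auto. intros v Hv.
    apply HkS. left. apply Slayer. apply arc_height in Hw, Hv. lia.
Qed.

Lemma siblings_in_twins u z z' : arc u z -> arc u z' -> in_twins arc z z'.
Proof.
  intros Hz Hz'. destruct (classic (z = z')) as [->|Hne]; [unfold in_twins; tauto|].
  destruct (in_twins_exist u z z') as [a [b [Nab Hab]]]; auto.
  destruct (in_neighbour a) as [t Ha]. assert (Hb : arc t b) by now apply Hab.
  destruct (homogeneous_siblings_transitive arc arc_digraph arc_homogeneous t a b u z z')
    as [g [Hg [_ [<- <-]]]]; eauto using siblings_nonadjacent.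
  now apply automorphism_in_twins.
Qed.

(* Moving [u] to its in-twin [u'] while fixing [v] takes [z] to a child of [u'] that is a sibling,
   hence an in-twin, of [z]. *)
Lemma siblings_inherit_shared_child w u u' v z :
  arc w u -> arc w u' -> arc u z -> arc v z -> v <> u -> arc u' z.
Proof.
  intros Hu Hu' Hz Hv Nvu. destruct (classic (v = u')) as [->|Nvu']; auto.
  destruct (in_neighbour v) as [w' Hw'].
  pose proof (arc_height _ _ Hu). pose proof (arc_height _ _ Hu').
  pose proof (arc_height _ _ Hz). pose proof (arc_height _ _ Hv). pose proof (arc_height _ _ Hw').
  destruct (layer_spanned_from_below (h w)) as [S [Sfin [Sconn [Slayer Sle]]]].
  assert (Sabove : forall s, S s -> h s <> h u) by (intros s Hs; apply Sle in Hs; lia).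
  destruct (homogeneous_move_vertex arc arc_digraph arc_homogeneous (fun s => S s \/ s = v) w
    u u') as [g [Hg [HgS Hgu]]]; auto; try (now left).
  - apply finite_union; auto using finite_singleton.
  - apply induced_connected_add with w'; auto; [apply Slayer; lia|now left].
  - intros [K| ->]; auto. now apply (Sabove u).
  - intros [K| ->]; auto. apply (Sabove u'); auto; lia.
  - intros s _. now apply (siblings_in_twins w).
  - intros s [Hs| ->]; [apply Sle in Hs|]; split; intros K; apply arc_height in K; lia.
  - apply (siblings_in_twins v (g z) z); auto.
    + rewrite <- (HgS v), automorphism_arc; auto.
    + rewrite <- Hgu, automorphism_arc; auto.
Qed.

(* The parent map is a surjection between layers of equal size. *)
Lemma unique_parents_unique_children : (forall x y z, arc x z -> arc y z -> x = y) ->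
  forall x z z', arc x z -> arc x z' -> z = z'.
Proof.
  intros Hpar x z z' Hz Hz'. destruct layers_same_card as [r Hr].
  destruct (functional_choice (fun y w => arc w y) in_neighbour) as [p Hp].
  assert (Hpeq : forall w y, arc w y -> p y = w) by (intros w y Hwy; now apply (Hpar _ _ y)).
  apply (has_card_surjective_injective _ _ p r (Hr (h x + 1)) (Hr (h x))); auto.
  - intros y Hy. destruct (out_neighbour y) as [t Ht]. exists t. split; auto.
    apply arc_height in Ht. lia.
  - now rewrite (Hpeq x z), (Hpeq x z').
Qed.

Lemma siblings_out_twins w u u' : arc w u -> arc w u' -> out_twins arc u u'.
Proof.
  assert (Hhalf : forall u u' z, arc w u -> arc w u' -> arc u z -> arc u' z).
  { clear u u'. intros u u' z Hu Hu' Hz.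
    destruct (classic (exists v, arc v z /\ v <> u)) as [[v [Hv Nv]]|Hno].
    - now apply (siblings_inherit_shared_child w u u' v z).
    - replace u' with u; auto. apply unique_parents_unique_children with w; auto.
      intros a b t Ha Hb. apply NNPP. intros Nab. apply Hno.
      destruct (homogeneous_arc_transitive arc arc_digraph arc_homogeneous a t u z)
        as [g [Hg [<- <-]]]; auto.
      exists (g b). split; [now apply automorphism_arc|].
      intros E. now apply Nab, (automorphism_injective arc g Hg). }
  intros Hu Hu' z. split; now apply Hhalf.
Qed.

End Layered.

(** * Consecutive layers are completely joined *)

Section Reversal.

Context {V : Type} (arc : V -> V -> Prop).

Lemma adj_transp x y : adj (transp V arc) x y <-> adj arc x y.
Proof. unfold adj, transp. tauto. Qed.

Lemma connected_transp : connected arc -> connected (transp V arc).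
Proof. intros H x y. apply rt_mono with (2 := H x y). intros a b. apply adj_transp. Qed.

Lemma automorphism_transp g : automorphism arc g -> automorphism (transp V arc) g.
Proof. intros [Hbij Harc]. split; auto. intros x y. apply Harc. Qed.

Lemma connected_homogeneous_transp :
  connected_homogeneous arc -> connected_homogeneous (transp V arc).
Proof.
  assert (Hconn : forall A, induced_connected (transp V arc) A -> induced_connected arc A).
  { intros A HA x y Hx Hy. apply rt_mono with (2 := HA x y Hx Hy).
    intros a b [Ha [Hb Hab]]. repeat split; auto. now apply adj_transp. }
  intros Hch A B f HA HB CA CB [Hmap [Hinj [Hsurj Harc]]].
  destruct (Hch A B f) as [g [Hg Hgf]]; auto.
  - repeat split; auto; now apply (Harc y x).
  - exists g. split; auto using automorphism_transp.
Qed.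

Lemma layering_transp h : layering arc h -> layering (transp V arc) (fun v => - h v)%Z.
Proof.
  intros [Harc Hfin]. split.
  - intros x y Hxy. apply Harc in Hxy. lia.
  - intros k. apply finite_subset with (2 := Hfin (- k)%Z). intros v. lia.
Qed.

End Reversal.

Definition twins {V : Type} (arc : V -> V -> Prop) (a b : V) : Prop :=
  in_twins arc a b /\ out_twins arc a b.

(* By induction along a path from [x], every vertex is a twin of the vertex of its layer on a fixed
   bi-infinite path through [x]. *)
Lemma twin_siblings_join_layers {V : Type} (arc : V -> V -> Prop) (h : V -> Z) x y :
  connected arc -> (forall x y, arc x y -> h y = (h x + 1)%Z) ->
  (forall x, exists y, arc x y) -> (forall y, exists x, arc x y) ->
  (forall u a b, arc u a -> arc u b -> twins arc a b) ->
  (forall u a b, arc a u -> arc b u -> twins arc a b) ->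
  h y = (h x + 1)%Z -> arc x y.
Proof.
  intros Hconn Hh Hout Hin Hsib Hcosib Hxy.
  destruct (bi_infinite_path arc x Hout Hin) as [c [c0 Hc]].
  assert (Hall : forall v, twins arc v (c (h v - h x)%Z)).
  { intros v.
    apply (connected_invariant arc (fun v => twins arc v (c (h v - h x)%Z)) Hconn) with x.
    - intros a b [Ha Ha'] [Hab|Hab]; pose proof (Hh _ _ Hab).
      + apply (Hsib (c (h a - h x)%Z)); [now apply Ha'|].
        replace (h b - h x)%Z with (h a - h x + 1)%Z by lia. apply Hc.
      + apply (Hcosib (c (h a - h x)%Z)); [now apply Ha|].
        replace (h a - h x)%Z with (h b - h x + 1)%Z by lia. apply Hc.
    - rewrite Z.sub_diag, c0. split; intros w; tauto. }
  apply (Hall y). replace (h y - h x)%Z with (0 + 1)%Z by lia. rewrite <- c0 at 1. apply Hc.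
Qed.

Definition complete_layers {V : Type} (arc : V -> V -> Prop) (h : V -> Z) (r : nat) : Prop :=
  (forall x y, arc x y <-> h y = (h x + 1)%Z) /\ forall k, has_card (fun v => h v = k) r.

Lemma layered_homogeneous_complete {V : Type} (arc : V -> V -> Prop) (h : V -> Z) :
  connected arc -> connected_homogeneous arc -> layering arc h -> (exists x y, arc x y) ->
  exists r, complete_layers arc h r.
Proof.
  intros Hconn Hch Hlay Hex.
  destruct (layers_same_card arc h Hconn Hch Hlay Hex) as [r Hr].
  exists r. split; auto. intros x y. split; [apply Hlay|].
  pose proof (layering_digraph arc h Hlay) as Hdig.
  pose proof (connected_transp arc Hconn) as Hconn'.
  pose proof (connected_homogeneous_transp arc Hch) as Hch'.
  pose proof (layering_transp arc h Hlay) as Hlay'.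
  assert (Hex' : exists x y, transp V arc x y) by (destruct Hex as [a [b Hab]]; now exists b, a).
  apply twin_siblings_join_layers; auto.
  - apply Hlay.
  - now apply homogeneous_out_neighbour.
  - now apply homogeneous_in_neighbour.
  - intros u a b Ha Hb. split.
    + now apply (siblings_in_twins arc h Hconn Hch Hlay Hex u).
    + now apply (siblings_out_twins arc h Hconn Hch Hlay Hex u).
  - intros u a b Ha Hb. split.
    + now apply (siblings_out_twins (transp V arc) _ Hconn' Hch' Hlay' Hex' u).
    + now apply (siblings_in_twins (transp V arc) _ Hconn' Hch' Hlay' Hex' u).
Qed.

(** * The digraphs J(r) *)

Lemma glue_layer_bijections {V W : Type} (h : V -> Z) (h' : W -> Z) d (Q : V -> W -> Prop) :
  (forall k, exists b, bijection_on (fun x => h x = k) (fun y => h' y = (k + d)%Z) b /\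
    forall x, h x = k -> Q x (b x)) ->
  exists f, Bijective f /\ (forall x, h' (f x) = (h x + d)%Z) /\ forall x, Q x (f x).
Proof.
  intros Hb. destruct (functional_choice _ Hb) as [b Hspec]. clear Hb.
  assert (Hf : forall x, h' (b (h x) x) = (h x + d)%Z) by (intros x; now apply Hspec).
  exists (fun x => b (h x) x). split; [|split]; auto.
  - apply injective_surjective_bijective.
    + intros x y E. assert (Exy : h x = h y) by (pose proof (Hf x); rewrite E, Hf in *; lia).
      rewrite Exy in E. now apply (Hspec (h y)).
    + intros y. destruct (Hspec (h' y - d)%Z) as [[_ [_ Hsurj]] _].
      destruct (Hsurj y) as [x [Hx <-]]; [lia|]. exists x. now rewrite Hx.
  - intros x. now apply Hspec.
Qed.

Lemma complete_layers_isomorphic {V W : Type} (arc : V -> V -> Prop) (arc' : W -> W -> Prop)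
  h h' r (f : V -> W) :
  complete_layers arc h r -> complete_layers arc' h' r -> isomorphic arc arc'.
Proof.
  intros [Harc Hcard] [Harc' Hcard'].
  destruct (glue_layer_bijections h h' 0 (fun _ _ => True)) as [g [Hg [Hgh _]]].
  - intros k.
    destruct (partial_injection_extends _ _ (fun _ => False) f r (Hcard k) (Hcard' (k + 0)%Z))
      as [b [Hb _]]; try tauto. now exists b.
  - exists g. split; [exact Hg|]. intros x y. rewrite Harc, Harc', !Hgh. lia.
Qed.

Lemma isomorphic_complete_layers {V W : Type} (arc : V -> V -> Prop) (arc' : W -> W -> Prop) h' r :
  isomorphic arc arc' -> complete_layers arc' h' r -> exists h, complete_layers arc h r.
Proof.
  intros [f [[g [Hgf Hfg]] Hf]] [Harc Hcard]. exists (fun x => h' (f x)). split.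
  - intros x y. now rewrite Hf.
  - intros k. apply has_card_bijection with (2 := Hcard k) (f := g). split; [|split].
    + intros y Hy. now rewrite Hfg.
    + intros x y _ _ E. now rewrite <- (Hfg x), <- (Hfg y), E.
    + intros x Hx. exists (f x). auto.
Qed.

Lemma induced_iso_shifts_layers {V : Type} (arc : V -> V -> Prop) (h : V -> Z) A B f :
  (forall x y, arc x y -> h y = (h x + 1)%Z) -> induced_connected arc A ->
  induced_iso arc A B f -> exists d, forall x, A x -> h (f x) = (h x + d)%Z.
Proof.
  intros Hh CA [_ [_ [_ Harc]]].
  destruct (classic (exists a, A a)) as [[a Ha]|Hempty].
  2: { exists 0%Z. intros x Hx. destruct Hempty. eauto. }
  exists (h (f a) - h a)%Z. intros x Hx.
  apply (rt_invariant (adj_in arc A) (fun v => h (f v) = (h v + (h (f a) - h a))%Z) a x);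
    [|now apply CA|lia].
  intros u v Hu [Au [Av [H|H]]]; pose proof (Hh _ _ H); apply Harc in H; auto;
    apply Hh in H; lia.
Qed.

Lemma complete_layers_homogeneous {V : Type} (arc : V -> V -> Prop) h r :
  complete_layers arc h r -> connected_homogeneous arc.
Proof.
  intros [Harc Hcard] A B f _ _ CA _ Hiso.
  destruct (induced_iso_shifts_layers arc h A B f) as [d Hd]; auto; [apply Harc|].
  destruct (glue_layer_bijections h h d (fun x y => A x -> y = f x)) as [g [Hg [Hgh HgA]]].
  - intros k.
    destruct (partial_injection_extends _ _ A f r (Hcard k) (Hcard (k + d)%Z)) as [b [Hb HbA]].
    + intros x <-. apply Hd.
    + intros x y _ Ax _ Ay. now apply Hiso.
    + now exists b.
  - exists g. split; auto. split; [exact Hg|]. intros x y. rewrite !Harc, !Hgh. lia.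
Qed.

Lemma Forall_sig_list {A : Type} (P : A -> Prop) l : Forall P l ->
  exists m : list {x | P x}, map (@proj1_sig A P) m = l.
Proof.
  induction 1 as [|a l Ha _ [m Hm]]; [now exists []|].
  exists (exist P a Ha :: m). simpl. now rewrite Hm.
Qed.

Lemma interval_has_card r : has_card (fun _ : {x : nat | 1 <= x <= r} => True) r.
Proof.
  destruct (Forall_sig_list (fun x => 1 <= x <= r) (seq 1 r)) as [m Hm].
  { apply Forall_forall. intros x Hx. apply in_seq in Hx. lia. }
  exists m. repeat split; auto.
  - apply (NoDup_map_inv (@proj1_sig _ _)). rewrite Hm. apply seq_NoDup.
  - intros _. destruct x as [x Hx].
    assert (K : In x (map (@proj1_sig _ _) m)) by (rewrite Hm; apply in_seq; lia).
    apply in_map_iff in K. destruct K as [[x' Hx'] [E Hin]]. simpl in E. subst x'.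
    now rewrite (proof_irrelevance _ Hx Hx').
  - rewrite <- (length_seq r 1), <- Hm. symmetry. apply length_map.
Qed.

Lemma J_complete_layers r : complete_layers (Jarc r) fst r.
Proof.
  split; [reflexivity|]. intros k.
  apply has_card_bijection with (2 := interval_has_card r) (f := pair k).
  split; [auto|]. split; [congruence|]. intros [k' i] E. simpl in E. subst. now exists i.
Qed.

Lemma complete_layers_isomorphic_J {V : Type} (arc : V -> V -> Prop) h r (x : V) :
  complete_layers arc h r -> isomorphic arc (Jarc r).
Proof.
  intros Hcl. destruct (proj2 Hcl (h x)) as [l [[_ Hl] Hlen]].
  assert (Hr : 1 <= 1 <= r) by (destruct l; [destruct (proj2 (Hl x) eq_refl)|simpl in Hlen; lia]).
  apply (complete_layers_isomorphic arc (Jarc r) h fst r (fun _ => (0%Z, exist _ 1 Hr)));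
    auto using J_complete_layers.
Qed.

Theorem theorem6p2 (V : Type) (arc : V -> V -> Prop) :
  is_digraph arc -> connected arc -> locally_finite arc -> has_exactly_two_ends arc ->
  (connected_homogeneous arc <-> exists r : nat, isomorphic arc (Jarc r)).
Proof.
  intros Hdig Hconn Hlf Hends. split.
  - intros Hch. pose proof (two_ended_has_arc arc Hends) as Hex.
    pose proof (homogeneous_vertex_transitive arc Hdig Hch) as Hvt.
    destruct (two_ended_height arc Hconn Hlf Hvt Hends) as [h [Hequiv Hfin]].
    destruct (layering_exists arc h Hdig Hconn Hch Hex (two_ended_infinite arc Hends) Hequiv Hfin)
      as [k Hk].
    destruct (layered_homogeneous_complete arc k Hconn Hch Hk Hex) as [r Hr], Hex as [x _].
    exists r. exact (complete_layers_isomorphic_J arc k r x Hr).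
  - intros [r Hr].
    destruct (isomorphic_complete_layers arc (Jarc r) fst r Hr (J_complete_layers r)) as [h Hh].
    exact (complete_layers_homogeneous arc h r Hh).
Qed.
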